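(* Let $\Phi$ be the oversampled discrete Fourier transform on $\mathcal{M}$. Let $x_0\in\mathbb{C}^n$, $n=|\mathcal M|$, be an object of rank $\ge 2$, let $\ell\ge 2$, and let at least one of the masks $\mu_j$, $j=1,\dots,\ell$, be independently and continuously distributed on the unit circle. Let $$A^*=c\begin{bmatrix}\Phi\,\mathrm{diag}\{\mu_1\}\\ \vdots\\ \Phi\,\mathrm{diag}\{\mu_\ell\}\end{bmatrix}$$ be isometric (i.e. $AA^*=I$), and let $b=|A^*x_0|$. Then, with probability one, the following holds. Let $y^{(k)}$, $k=1,2,\dots$, be an FDR sequence, i.e. $y^{(k+1)}=S_{\rm f}(y^{(k)})$ with $$S_{\rm f}(y)=y+A^*A\Big(2b\odot\frac{y}{|y|}-y\Big)-b\odot\frac{y}{|y|},$$ and let $x^{(k)}:=Ay^{(k)}$. If $x^{(1)}$ is sufficiently close to $x_0$, then for some constant $\gamma<1$ $$\|\alpha^{(k)}x^{(k)}-x_0\|\le\gamma^{k-1}\|x^{(1)}-x_0\|,\qquad\forall k,$$ where $\alpha^{(k)}:=\arg\min_{\alpha}\{\|\alpha x^{(k)}-x_0\|:\ |\alpha|=1,\ \alpha\in\mathbb{C}\}$.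
   Context: Let $d\ge2$, $\mathcal M=\{(m_1,\dots,m_d)\in\mathbb Z^d:0\le m_j\le M_j\}$, $\widetilde{\mathcal M}=\{(m_1,\dots,m_d)\in\mathbb{Z}^d:-M_j\le m_j\le M_j\}$ and $\mathcal L=\{(w_1,\dots,w_d): w_j\in\{0,\tfrac1{2M_j+1},\dots,\tfrac{2M_j}{2M_j+1}\}\}$. The oversampled DFT $\Phi\in\mathbb{C}^{|\widetilde{\mathcal M}|\times|\mathcal M|}$ has entries $e^{-2\pi i\,\mathbf n\cdot\mathbf w}$, $\mathbf w\in\mathcal L$, $\mathbf n\in\mathcal M$. Objects are functions on $\mathcal M$, identified with vectors in $\mathbb{C}^n$, $n=|\mathcal M|$. $x_0$ has rank $\ge2$ if the convex hull of its support in $\mathbb{Z}^d$ has dimension two or higher. A (phase) mask $\mu$ is a function on $\mathcal M$ with values of modulus one; it is independently and continuously distributed on the unit circle if $\mu(\mathbf n)=e^{i\phi(\mathbf n)}$ with $\phi(\mathbf n)$ independent continuous real-valued random variables. $c$ is a normalizing constant. $|\cdot|$, $\odot$ and division of vectors are component-wise; the phase $y(j)/|y(j)|$ is set to $1$ when $y(j)=0$.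
   Formalization: The FDR sequence is required to start at y^(1)=A^*x^(1) (the claim fails if y^(1) may have an arbitrary component in ker A), and the independently and continuously distributed mask is also required to be independent of the other masks (it can fail if, e.g., two masks coincide). *)

(* Defs.v *)
From HB Require Import structures.
From mathcomp Require Import all_boot all_order all_algebra spectral.
From mathcomp Require Import complex.
From mathcomp Require Import all_classical all_reals all_analysis.

Set Implicit Arguments.
Unset Strict Implicit.
Unset Printing Implicit Defensive.

Import Order.TTheory GRing.Theory Num.Theory.
Import numFieldNormedType.Exports.

Local Open Scope classical_set_scope.
Local Open Scope ring_scope.
Local Open Scope complex_scope.
Local Open Scope sesquilinear_scope.

(* The box {n in Z^d : 0 <= n_j <= N_j}. *)
Definition grid (d : nat) (N : 'I_d -> nat) : finType :=
  {dffun forall j : 'I_d, 'I_(N j).+1}.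

Definition coord (d : nat) (N : 'I_d -> nat) (n : grid N) (j : 'I_d) : nat :=
  (n : {dffun forall j : 'I_d, 'I_(N j).+1}) j.

(* A frequency w is stored as the integers k_j = (2 M_j + 1) w_j, which range
   over 0, ..., 2 M_j; there are as many of them as points of M-tilde. *)
Definition freqs (d : nat) (M : 'I_d -> nat) : finType :=
  grid (fun j => (M j).*2).

(* Functions on the grid, as column vectors indexed through enum_val. *)
Notation object R M := ('cV[R[i]]_#|grid M|).

Definition expi (R : realType) (t : R) : R[i] := cos t +i* sin t.

Definition dft (R : realType) (d : nat) (M : 'I_d -> nat) :
    'M[R[i]]_(#|freqs M|, #|grid M|) :=
  \matrix_(w, n) expi (- (2 * pi *
    \sum_(j < d) (coord (enum_val n) j)%:R * ((coord (enum_val w) j)%:R / (M j).*2.+1%:R))).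

(* The measurement matrix A^*; the operator written A is its adjoint. *)
Definition Astar (R : realType) (d : nat) (M : 'I_d -> nat) (l : nat)
    (c : R[i]) (mu : 'I_l -> grid M -> R[i]) :
    'M[R[i]]_(\sum_(j < l) #|freqs M|, #|grid M|) :=
  c *: \mxcol_(j < l) (dft R M *m diag_mx (\row_n mu j (enum_val n))).

Section Vectors.
Variables (R : realType) (m : nat).
Implicit Types u v : 'cV[R[i]]_m.

Definition norm2 v : R := Num.sqrt (\sum_i complex.Re (`|v i 0| ^+ 2)).

Definition absv v : 'cV[R[i]]_m := \col_i `|v i 0|.

Definition phase v : 'cV[R[i]]_m :=
  \col_i (if v i 0 == 0 then 1 else v i 0 / `|v i 0|).

Definition hadamard u v : 'cV[R[i]]_m := \col_i (u i 0 * v i 0).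

Definition is_phase_argmin (x x0 : 'cV[R[i]]_m) (a : R[i]) : Prop :=
  `|a| = 1 /\
  forall a' : R[i], `|a'| = 1 -> norm2 (a *: x - x0) <= norm2 (a' *: x - x0).

End Vectors.

Definition Sf (R : realType) (N n : nat) (As : 'M[R[i]]_(N, n))
    (b y : 'cV[R[i]]_N) : 'cV[R[i]]_N :=
  y + As *m (As^t* *m (2 *: hadamard b (phase y) - y)) - hadamard b (phase y).

Section Rank.
Variables (R : realType) (d : nat).

Definition conv_hull (S : set 'rV[R]_d) : set 'rV[R]_d :=
  [set p | exists (m : nat) (t : 'I_m -> R) (q : 'I_m -> 'rV[R]_d),
    [/\ forall i, 0 <= t i, \sum_i t i = 1, forall i, S (q i)
      & p = \sum_i t i *: q i]].

(* A convex set has dimension at least k when it contains k + 1 affinely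
   independent points. *)
Definition dim_ge (k : nat) (K : set 'rV[R]_d) : Prop :=
  exists p : 'I_k.+1 -> 'rV[R]_d,
    (forall i, K (p i)) /\
    row_free (\matrix_(i < k) (p (lift ord0 i) - p ord0)).

Definition support_pts (M : 'I_d -> nat) (x0 : object R M) : set 'rV[R]_d :=
  [set \row_j ((coord (enum_val n) j)%:R : R) | n in [set n | x0 n 0 != 0]].

Definition rank_ge2 (M : 'I_d -> nat) (x0 : object R M) : Prop :=
  dim_ge 2 (conv_hull (support_pts x0)).

End Rank.

Section Independence.
Context (R : realType) (disp : measure_display) (T : measurableType disp).
Variable P : probability T R.

Definition mutually_independent (I : finType) (X : I -> {RV P >-> R}) : Prop :=
  forall (J : {set I}) (B : I -> set R), (forall i, measurable (B i)) ->
    P (\bigcap_(i in [set` J]) (X i @^-1` B i))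
    = (\prod_(i in J) P (X i @^-1` B i))%E.

(* Independence of the sigma-algebras generated by two finite families, tested
   on the pi-systems of rectangles that generate them. *)
Definition families_independent (I K : finType)
    (X : I -> {RV P >-> R}) (Y : K -> {RV P >-> R}) : Prop :=
  forall (B : I -> set R) (C : K -> set R),
    (forall i, measurable (B i)) -> (forall k, measurable (C k)) ->
    (P ((\bigcap_i (X i @^-1` B i)) `&` (\bigcap_k (Y k @^-1` C k)))
     = P (\bigcap_i (X i @^-1` B i)) * P (\bigcap_k (Y k @^-1` C k)))%E.

Definition continuously_distributed (X : {RV P >-> R}) : Prop :=
  continuous (cdf X).

Section Masks.
Variables (d : nat) (M : 'I_d -> nat) (l : nat).
(* Masks are given by their phases, mu_j(n) = exp(i phi_j(n)); a deterministic
   mask is one with constant phases. *)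
Variable phi : 'I_l -> grid M -> {RV P >-> R}.

Definition masks (t : T) (j : 'I_l) (n : grid M) : R[i] := expi (phi j n t).

(* The last clause says that mask j0 is independent of the remaining masks. It
   cannot be omitted: with two identical masks the second one would carry no
   information. It is automatic when the remaining masks are deterministic. *)
Definition independent_continuous_mask (j0 : 'I_l) : Prop :=
  [/\ forall n, continuously_distributed (phi j0 n),
      mutually_independent (phi j0)
    & families_independent (phi j0)
        (fun p : {j : 'I_l | j != j0} * grid M => phi (val p.1) p.2)].

End Masks.
End Independence.

(* Main.v *)
(* Near the orbit of y0 = A^* x0 the FDR map is, up to an error bilinear in the
   transversal offset and the total offset, the linear Douglas-Rachford map
   J = P Q + (1 - P)(1 - Q) of two real orthogonal projections: P onto the range
   of A^*, and Q onto the directions tangent to the torus |y| = b.  Since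
   |J v|^2 + |(P - Q) v|^2 = |v|^2, J contracts strictly on the range of P - Q,
   while the kernel of P - Q is (range P /\ range Q) + (ker P /\ ker Q).  The
   second summand consists of fixed points of the nonlinear map that A does not
   see; the first one is the line spanned by i y0 as soon as the only x with
   A^* x / A^* x0 real are the real multiples of x0, and this line is absorbed
   by the choice of the phase.

   That uniqueness holds almost surely.  By Fourier inversion on the oversampled
   lattice it says that x and x0 are determined by Hermitian symmetry of their
   masked cross-correlations.  Order Z^d by an injective additive functional and
   let t, b be the extreme points of the support of x0.  Comparing the extreme
   coefficients of the correlations for two masks with ratio rho shows that any
   other solution has extreme points T, B with T + B = t + b and
   rho(T) rho(B) = rho(t) rho(b).  For a generic mask this forces
   {T, B} = {t, b}; a solution vanishing at t would then be supported at the two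
   extreme points only, which a third support point of x0 excludes. *)
Require Import Defs.
From HB Require Import structures.
From mathcomp Require Import all_boot all_order all_algebra spectral.
From mathcomp Require Import complex.
From mathcomp Require Import all_classical all_reals all_analysis.
From mathcomp Require Import measurable_realfun.
From mathcomp Require Import ring lra zify.

Set Implicit Arguments.
Unset Strict Implicit.
Unset Printing Implicit Defensive.

Import Order.TTheory GRing.Theory Num.Theory.
Import numFieldNormedType.Exports.

Local Open Scope classical_set_scope.
Local Open Scope ring_scope.
Local Open Scope complex_scope.
Local Open Scope sesquilinear_scope.

Import Normc.

(* [vector.coord] shadows the coordinates of a grid point. *)
Local Notation coord := Defs.coord.

(** * Atomless random phases *)

Section AtomlessCoincidence.
Context (R : realType) (disp : measure_display) (T : measurableType disp).
Variable P : probability T R.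
Local Open Scope ereal_scope.

(** The events independent of [A] form a Dynkin system, so by the pi-lambda theorem independence
    passes from a pi-system to the sigma-algebra it generates. *)
Lemma indep_sigma (A : set T) (G : set (set T)) : measurable A ->
  setI_closed G -> G `<=` measurable ->
  (forall E, G E -> P (A `&` E) = P A * P E) ->
  forall E, <<s G >> E -> P (A `&` E) = P A * P E.
Proof.
move=> mA GI mG GP E sE.
suff: <<s G >> `<=` [set E | measurable E /\ P (A `&` E) = P A * P E].
  by move=> /(_ _ sE)[].
apply: lambda_system_subset => //; last first.
  by move=> B GB; split; [exact: mG|exact: GP].
have finP B : measurable B -> P B \is a fin_num.
  by move=> mB; exact: fin_num_measure.
apply/dynkin_lambda_system; split => //=.
- by split; [exact: measurableT|rewrite setIT probability_setT mule1].
- move=> B [mB PB]; split; first exact: measurableC.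
  rewrite -setDE measureD //; last first.
    by rewrite (le_lt_trans (probability_le1 _ _))// ltry.
  by rewrite /= PB probability_setC// muleBr ?mule1// finP.
- move=> F tF FH; split.
    by apply: bigcup_measurable => k _; have [] := FH k.
  rewrite setI_bigcupr measure_bigcup//; last 2 first.
    by move=> k _; apply: measurableI => //; have [] := FH k.
    by apply: trivIset_setIl.
  rewrite measure_bigcup//; last by move=> k _; have [] := FH k.
  rewrite -[P A]fineK ?finP// -nneseriesZl//; apply: eq_eseriesr => k _.
  by rewrite fineK ?finP//; exact: (FH k).2.
Qed.

(** The half-line up to [r - 1/(n+1)] and the point [r] are disjoint inside the half-line up to [r];
    as [n] grows, continuity leaves no mass for the point. *)
Lemma continuous_cdf_set1 (X : {RV P >-> R}) (r : R) :
  continuous (cdf X) -> distribution P X [set r] = 0.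
Proof.
move=> cX; apply/eqP; rewrite eq_le measure_ge0 andbT.
pose u (n : nat) := cdf X (r - n.+1%:R^-1)%R.
have ur : u n @[n --> \oo] --> cdf X r.
  apply: continuous_cvg; first exact: cX.
  rewrite -[X in _ --> X](@subr0 R).
  by apply: cvgB; [exact: cvg_cst|exact: cvg_harmonic].
have finX : cdf X r \is a fin_num by exact: fin_num_measure.
suff : cdf X r + distribution P X [set r] <= cdf X r.
  by rewrite -leeBrDl// subee.
have h : u n + distribution P X [set r] @[n --> \oo] -->
    cdf X r + distribution P X [set r].
  by apply: cvgeD; [exact: fin_num_adde_defr|exact: ur|exact: cvg_cst].
apply: (cvge_to_le h).
apply: nearW => n; rewrite /u /cdf -measureU//=; last first.
  apply/seteqP; split => // x /= []; rewrite in_itv/= => xr xE; move: xr.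
  by rewrite xE leNgt ltrBlDr ltrDl invr_gt0 ltr0n.
rewrite le_measure ?inE//; first exact: measurableU.
move=> x /= []; rewrite !in_itv/=; last by move=> ->.
by move=> /le_trans; apply; rewrite gerBl invr_ge0.
Qed.

(** By independence the joint law is a product measure, and Fubini reduces the claim to the sections
    of [E], which are countable and hence null for an atomless law. *)
Lemma atomless_coincidence (U W : {RV P >-> R}) (E : set (R * R)) :
  (forall A B, measurable A -> measurable B ->
    P (U @^-1` A `&` W @^-1` B) = P (U @^-1` A) * P (W @^-1` B)) ->
  continuously_distributed U ->
  measurable E ->
  (forall w, exists f : nat -> R, [set u | E (w, u)] `<=` range f) ->
  P [set t | E (W t, U t)] = 0.
Proof.
move=> UW cU mE cE.
have mWU : measurable_fun setT (fun t => (W t, U t)) by exact/measurable_fun_pair.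
pose V : {mfun T >-> (R * R)%type} :=
  HB.pack (fun t => (W t, U t)) (isMeasurableFun.Build _ _ _ _ _ mWU).
have -> : P [set t | E (W t, U t)] = distribution P V E by [].
rewrite -(@product_measure_unique _ _ _ _ _ (distribution P W)
  (distribution P U) (distribution P V))//; last first.
  move=> A B mA mB; rewrite [RHS]muleC -[RHS]UW// setIC; congr (P _).
apply: integral0_eq => w _ /=.
have [f fE] := cE w.
have mEw : measurable (xsection E w) by exact: measurable_xsection.
apply/(negligibleP _ mEw).
apply: (@negligibleS _ _ _ _ (\bigcup_n [set f n])).
  by move=> x; rewrite /xsection /= inE => /fE[n _ <-]; exists n.
apply: negligible_bigcup => n.
by apply/negligibleP => //; exact: continuous_cdf_set1.
Qed.
End AtomlessCoincidence.

Lemma cos_eq1 (R : realType) (x : R) : cos x = 1 -> exists k : int, x = 2 * pi * k%:~R.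
Proof.
move=> cx1; have p0 := pi_gt0 R.
have tp0 : 0 < 2 * pi :> R by lra.
exists (Num.floor (x / (2 * pi))).
set k := Num.floor _.
have [kl ku] : k%:~R * (2 * pi) <= x /\ x < (k%:~R + 1) * (2 * pi).
  rewrite -ler_pdivlMr// -ltr_pdivrMr//; split; first exact: floor_le_tmp.
  by have := floorD1_gt (x / (2 * pi)); rewrite intrD.
pose y := x - 2 * pi * k%:~R.
have cy : cos y = 1.
  have cosk (n : nat) (z : R) : cos (z + pi *+ 2 *+ n) = cos z.
    by apply: periodicn; exact: cosD2pi.
  rewrite /y -[RHS]cx1; case: (k) => n.
    rewrite -(cosk n); congr cos.
    by rewrite -[_ *+ n]mulr_natr -[pi *+ 2]mulr_natr -pmulrn; ring.
  rewrite NegzE -(cosk n.+1 x); congr cos.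
  rewrite -[_ *+ n.+1]mulr_natr -[pi *+ 2]mulr_natr mulrNz -pmulrn.
  by ring.
have y0 : 0 <= y by rewrite /y; lra.
have y2 : y < 2 * pi by rewrite /y; lra.
suff : y = 0 by rewrite /y; lra.
(* Cosine is injective on [[0, pi]]; the other half of the period is reflected by [2 * pi - y]. *)
have [yp|py] := leP y pi.
  apply: cos_inj; rewrite ?in_itv/= ?cos0 ?y0 ?lexx//; lra.
have : 2 * pi - y = 0.
  apply: cos_inj; rewrite ?in_itv/= ?lexx/=; [lra|lra|].
  have -> : 2 * pi - y = - y + pi *+ 2 by rewrite -[pi *+ 2]mulr_natr; ring.
  by rewrite cosD2pi cosN cos0.
lra.
Qed.

Lemma expi_eq (R : realType) (u w : R) :
  expi u = expi w -> exists k : int, u = w + 2 * pi * k%:~R.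
Proof.
move=> [cE sE].
have [|k kE] := @cos_eq1 R (u - w); last by exists k; lra.
by rewrite cosB cE sE -!expr2 cos2Dsin2.
Qed.

Section LinearCombinations.
Context (R : realType) (disp : measure_display) (T : measurableType disp).
Variable P : probability T R.

(** As [a i0 = 0], [W] is measurable for the sigma-algebra of all variables other than [X i0].
    Rectangles in those variables form a pi-system, on which independence from [X i0] follows from
    the two hypotheses. *)
Lemma indep_linear_combination (I K : finType) (X : I -> {RV P >-> R})
    (Y : K -> {RV P >-> R}) (i0 : I) (a : I -> R) (b : K -> R) (W : T -> R) :
  mutually_independent X -> families_independent X Y -> a i0 = 0 ->
  W = (fun t => \sum_i a i * X i t + \sum_k b k * Y k t) ->
  forall A B, measurable A -> measurable B ->
  (P (X i0 @^-1` A `&` W @^-1` B) = P (X i0 @^-1` A) * P (W @^-1` B))%E.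
Proof.
move=> Xind XYind a0 WE A B mA mB.
pose rect (C : I -> set R) (D : K -> set R) :=
  (\bigcap_i (X i @^-1` C i)) `&` (\bigcap_k (Y k @^-1` D k)).
pose G : set (set T) := [set E | exists C D,
  [/\ forall i, measurable (C i), forall k, measurable (D k), C i0 = setT
    & E = rect C D]].
have mX i C : measurable C -> measurable (X i @^-1` C).
  by move=> mC; rewrite -[_ @^-1` _]setTI; exact: measurable_funP.
have mY k C : measurable C -> measurable (Y k @^-1` C).
  by move=> mC; rewrite -[_ @^-1` _]setTI; exact: measurable_funP.
have Prect C D : (forall i, measurable (C i)) -> (forall k, measurable (D k)) ->
    (P (rect C D) = (\prod_i P (X i @^-1` C i)) *
      P (\bigcap_k (Y k @^-1` D k)))%E.
  move=> mC mD; rewrite XYind//; congr (_ * _)%E.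
  have /= := Xind [set: I]%SET C mC.
  rewrite [in X in _ = X -> _](eq_bigl xpredT); last by move=> i; rewrite inE.
  move=> <-; congr (P _).
  apply/seteqP; split => t h i _; last by apply: h; rewrite /= inE.
  exact: h.
have mrect C D : (forall i, measurable (C i)) -> (forall k, measurable (D k)) ->
    measurable (rect C D).
  move=> mC mD; apply: measurableI; apply: fin_bigcap_measurable => //.
    by move=> i _; exact: mX.
  by move=> k _; exact: mY.
apply: (@indep_sigma _ _ _ _ _ G).
- exact: mX.
- move=> _ _ [C [D [mC mD C0 ->]]] [C' [D' [mC' mD' C'0 ->]]].
  exists (fun i => C i `&` C' i), (fun k => D k `&` D' k); split.
  + by move=> i; exact: measurableI.
  + by move=> k; exact: measurableI.
  + by rewrite C0 C'0 setIT.
  + apply/seteqP; split => t.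
      move=> [[h1 h2] [h3 h4]]; split => i _; split;
        by [exact: h1|exact: h2|exact: h3|exact: h4].
    move=> [h1 h2]; split; split => i _.
    * by have [] := h1 i Logic.I.
    * by have [] := h2 i Logic.I.
    * by have [] := h1 i Logic.I.
    * by have [] := h2 i Logic.I.
- by move=> _ [C [D [mC mD C0 ->]]]; exact: mrect.
- move=> _ [C [D [mC mD C0 ->]]].
  (* [C i0] is the whole line, so this slot is free to receive the constraint [A], and the
     intersection is again a rectangle. *)
  pose C1 i := if i == i0 then A else C i.
  have -> : X i0 @^-1` A `&` rect C D = rect C1 D.
    apply/seteqP; split => t.
      move=> [h0 [h1 h2]]; split => // i _; rewrite /C1 /=.
      by case: eqP => [->//|_]; exact: h1.
    move=> [h1 h2]; split; first by have := h1 i0 Logic.I; rewrite /C1/= eqxx.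
    split => // i _; have := h1 i Logic.I; rewrite /C1/=.
    by case: eqP => [->|//]; rewrite C0.
  rewrite !Prect//; last by move=> i; rewrite /C1; case: ifP.
  rewrite muleA; congr (_ * _)%E.
  rewrite (bigD1 i0)//= [in RHS](bigD1 i0)//= /C1 eqxx C0 preimage_setT.
  rewrite probability_setT mul1e; congr (_ * _)%E.
  by apply: eq_bigr => i /negPf ->.
have mX' i : i != i0 ->
    measurable_fun [set: g_sigma_algebraType G] (fun t => X i t).
  move=> ii0 _ C mC; rewrite setTI; apply: sub_sigma_algebra.
  exists (fun j => if j == i then C else setT), (fun=> setT); split => //.
  + by move=> j; case: ifP.
  + by rewrite eq_sym (negPf ii0).
  + apply/seteqP; split => t.
      by move=> h; split => // j _ /=; case: eqP => [->|].
    by move=> [h _]; have := h i Logic.I; rewrite /= eqxx.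
have mY' k : measurable_fun [set: g_sigma_algebraType G] (fun t => Y k t).
  move=> _ C mC; rewrite setTI; apply: sub_sigma_algebra.
  exists (fun=> setT), (fun j => if j == k then C else setT); split => //.
  + by move=> j; case: ifP.
  + apply/seteqP; split => t.
      by move=> h; split => // j _ /=; case: eqP => [->|].
    by move=> [_ h]; have := h k Logic.I; rewrite /= eqxx.
have : measurable_fun [set: g_sigma_algebraType G] W.
  rewrite WE; apply: measurable_funD.
    apply: measurable_sum => i; have [->|ii0] := eqVneq i i0.
      by rewrite a0; under eq_fun do rewrite mul0r; exact: measurable_cst.
    by apply: measurable_funM => //; exact: mX'.
  by apply: measurable_sum => k; apply: measurable_funM => //; exact: mY'.
by move=> /(_ measurableT _ mB); rewrite setTI.
Qed.

Lemma measurable_expi_eq : measurable [set p : R * R | expi p.2 = expi p.1].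
Proof.
have -> : [set p : R * R | expi p.2 = expi p.1] =
    [set p : R * R | cos p.2 - cos p.1 = 0] `&` [set p : R * R | sin p.2 - sin p.1 = 0].
  apply/seteqP; split => [[w u] [] /= -> ->|[w u] /= []]; first by rewrite !subrr.
  by rewrite /expi => /subr0_eq -> /subr0_eq ->.
have mc : measurable_fun setT (@cos R) by apply: continuous_measurable_fun; exact: continuous_cos.
have ms : measurable_fun setT (@sin R) by apply: continuous_measurable_fun; exact: continuous_sin.
have mB (f : R -> R) : measurable_fun setT f ->
    measurable [set p : R * R | f p.2 - f p.1 = 0].
  move=> mf; have mf2 : measurable_fun setT (fun p : R * R => f p.2 - f p.1).
    apply: measurable_funB.
      exact: (measurableT_comp mf measurable_snd).
    exact: (measurableT_comp mf measurable_fst).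
  by have := mf2 measurableT _ (measurable_set1 0); rewrite setTI.
by apply: measurableI; exact: mB.
Qed.

Lemma expi_coincidence (I K : finType) (X : I -> {RV P >-> R})
    (Y : K -> {RV P >-> R}) (i0 : I) (a : I -> R) (b : K -> R) :
  mutually_independent X -> families_independent X Y ->
  continuously_distributed (X i0) -> a i0 = 0 ->
  {ae P, forall t, expi (X i0 t) <> expi (\sum_i a i * X i t + \sum_k b k * Y k t)}.
Proof.
move=> Xi XYi cX a0.
pose W t := \sum_i a i * X i t + \sum_k b k * Y k t.
have mW : measurable_fun setT W.
  apply: measurable_funD; apply: measurable_sum => i; exact: measurable_funM.
pose V : {mfun T >-> R} := HB.pack W (isMeasurableFun.Build _ _ _ _ _ mW).
have VP A B (mA : measurable A) (mB : measurable B) : 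
    (P (X i0 @^-1` A `&` V @^-1` B) = P (X i0 @^-1` A) * P (V @^-1` B))%E.
  exact: (indep_linear_combination Xi XYi a0 (erefl W)).
have h := atomless_coincidence VP cX measurable_expi_eq.
have {}h : P [set t | expi (X i0 t) = expi (W t)] = 0%E.
  apply: h => w.
  (* The solutions form [w + 2 pi Z], enumerated through the codes of integers; the default [0]
     serves the numbers that code none. *)
  exists (fun n => w + 2 * pi * (odflt 0 (choice.unpickle n : option int))%:~R).
  move=> u /= /expi_eq[k ->]; exists (choice.pickle k) => //.
  by rewrite choice.pickleK.
exists [set t | expi (X i0 t) = expi (W t)]; split => //; last first.
  by move=> t /= /contrapT.
have mWX : measurable_fun setT (fun t => (W t, X i0 t)) by exact/measurable_fun_pair.
by have := mWX measurableT _ measurable_expi_eq; rewrite setTI.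
Qed.
End LinearCombinations.

Lemma expiD (R : realType) (x y : R) : expi (x + y) = expi x * expi y.
Proof. by rewrite /expi cosD sinD; simpc; congr (_ +i* _); ring. Qed.

Lemma expi0 (R : realType) : expi (0 : R) = 1.
Proof. by rewrite /expi cos0 sin0. Qed.

Lemma expiN (R : realType) (x : R) : expi (- x) = Num.conj (expi x).
Proof. by rewrite /expi cosN sinN. Qed.

Lemma expiVE (R : realType) (x : R) : expi x * expi (- x) = 1.
Proof. by rewrite -expiD subrr expi0. Qed.

Lemma expi_neq0 (R : realType) (x : R) : expi x != 0.
Proof. by apply/eqP => h; have := expiVE x; rewrite h mul0r => /esym/eqP; rewrite oner_eq0. Qed.

Lemma sum_indicator (R : realType) (I : finType) (i0 : I) (F : I -> R) :
  \sum_i (i == i0)%:R * F i = F i0.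
Proof.
rewrite (bigD1 i0)//= eqxx mul1r big1 ?addr0// => i /negPf ->.
by rewrite mul0r.
Qed.

(** Equality of the two products would express [phi j0 p], modulo [2 pi], as an integer combination
    of the other phases, because [p] differs from [q], [m] and [m']. This is a null event, and there
    are finitely many quadruples. *)
Lemma generic_masks (R : realType) (disp : measure_display)
    (T : measurableType disp) (P : probability T R) (d : nat)
    (M : 'I_d -> nat) (l : nat) (phi : 'I_l -> grid M -> {RV P >-> R})
    (j0 j1 : 'I_l) : independent_continuous_mask phi j0 -> j1 != j0 ->
  {ae P, forall t, forall p q m m' : grid M, p != q -> p != m -> p != m' ->
    masks phi t j0 p * masks phi t j0 q * (masks phi t j1 m * masks phi t j1 m')
    <> masks phi t j0 m * masks phi t j0 m' * (masks phi t j1 p * masks phi t j1 q)}.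
Proof.
move=> [cX Xind XYind] j10.
apply: filter_forall => p; apply: filter_forall => q.
apply: filter_forall => m; apply: filter_forall => m'.
have [->|pq] := eqVneq p q; first by apply: aeW => t /=; rewrite ?eqxx.
have [->|pm] := eqVneq p m; first by apply: aeW => t /=; rewrite ?eqxx.
have [->|pm'] := eqVneq p m'; first by apply: aeW => t /=; rewrite ?eqxx.
pose J : {j : 'I_l | j != j0} := exist _ j1 j10.
(* [a] and [b] are the coefficients obtained by solving the equality of phases for [phi j0 p]. *)
pose a (n : grid M) : R := (n == m)%:R + (n == m')%:R - (n == q)%:R.
pose b (k : {j : 'I_l | j != j0} * grid M) : R :=
  (k == (J, p))%:R + (k == (J, q))%:R - (k == (J, m))%:R - (k == (J, m'))%:R.
have a0 : a p = 0 by rewrite /a (negPf pm) (negPf pm') (negPf pq) !addr0 subrr.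
apply: filterS (expi_coincidence b Xind XYind (cX p) a0) => t h _ _ _ e.
apply: h.
under eq_bigr do rewrite /a mulrBl mulrDl.
under [X in _ + X]eq_bigr do rewrite /b !mulrBl mulrDl.
rewrite !(sumrB, big_split)/= !sum_indicator /=.
move: e; rewrite /masks; set x := phi j0 p t; set y := phi j0 q t.
move=> e; rewrite !expiD.
set z := expi x; have -> : z = z * (expi y * expi (- y)) * 
   (expi (phi j1 m t) * expi (- (phi j1 m t))) * 
   (expi (phi j1 m' t) * expi (- (phi j1 m' t))) by rewrite !expiVE !mulr1.
transitivity ((z * expi y * (expi (phi j1 m t) * expi (phi j1 m' t))) *
  (expi (- y) * expi (- (phi j1 m t)) * expi (- (phi j1 m' t)))); first by ring.
by rewrite e; ring.
Qed.

(** * Uniqueness from masked cross-correlations *)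

Section CrossCorrelation.
Variables (F : fieldType) (d : nat) (M : 'I_d -> nat).
Local Notation G := (grid M).

(* [n - m = n0 - m0], without subtracting natural numbers. *)
Definition same_shift (n m n0 m0 : G) : bool :=
  [forall j, (coord n j + coord m0 j == coord n0 j + coord m j)%N].

(* [x'] and [x0'] stand for the conjugates of [x] and [x0]; making them
   independent turns a real-linear problem into a linear one. *)
Definition cross_corr (rho x x' x0 x0' : G -> F) (n0 m0 : G) : F :=
  \sum_(p : G * G | same_shift p.1 p.2 n0 m0)
    rho p.1 / rho p.2 * (x p.1 * x0' p.2 - x' p.2 * x0 p.1).

Lemma coord_inj (n m : G) : (forall j, coord n j = coord m j) -> n = m.
Proof. by move=> h; apply/ffunP => j; apply/val_inj; exact: h. Qed.

Lemma same_shift_refl n m : same_shift n m n m.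
Proof. by apply/forallP => j; rewrite addnC. Qed.

Lemma same_shiftP n m n0 m0 :
  reflect (forall j, coord n j + coord m0 j = coord n0 j + coord m j)%N
    (same_shift n m n0 m0).
Proof. exact: 'forall_eqP. Qed.

Lemma sum_single (n0 m0 A B : G) (W : G -> G -> F) :
  (forall n m, same_shift n m n0 m0 -> W n m != 0 -> n = A /\ m = B) ->
  \sum_(p : G * G | same_shift p.1 p.2 n0 m0) W p.1 p.2 =
    if same_shift A B n0 m0 then W A B else 0.
Proof.
move=> h; case: ifP => hAB.
  rewrite (bigD1 (A, B))//= big1 ?addr0// => -[n m] /= /andP[hnm ne].
  apply/eqP; apply: contraNT ne => /(h _ _ hnm)[-> ->]; exact: eqxx.
rewrite big1// => -[n m] /= hnm; apply/eqP; apply: contraFT hAB.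
by move=> /(h _ _ hnm)[<- <-].
Qed.

Lemma cross_corrB rho x x' y y' x0 x0' a n0 m0 :
  cross_corr rho (fun n => x n - a * y n) (fun n => x' n - a * y' n) x0 x0' n0 m0
  = cross_corr rho x x' x0 x0' n0 m0 - a * cross_corr rho y y' x0 x0' n0 m0.
Proof.
rewrite /cross_corr mulr_sumr -sumrB; apply: eq_bigr => p _.
by ring.
Qed.

Lemma cross_corr_self rho x0 x0' n0 m0 : cross_corr rho x0 x0' x0 x0' n0 m0 = 0.
Proof.
by rewrite /cross_corr big1// => p _; rewrite [x0' _ * _]mulrC subrr mulr0.
Qed.

Lemma cross_corr_split rho x x' x0 x0' n0 m0 :
  cross_corr rho x x' x0 x0' n0 m0 =
  \sum_(p : G * G | same_shift p.1 p.2 n0 m0) rho p.1 / rho p.2 * x p.1 * x0' p.2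
  - \sum_(p : G * G | same_shift p.1 p.2 n0 m0) rho p.1 / rho p.2 * x' p.2 * x0 p.1.
Proof.
by rewrite /cross_corr -sumrB; apply: eq_bigr => p _; rewrite mulrBr !mulrA.
Qed.

Section Extreme.
Variable E : G -> int.
Hypothesis Einj : injective E.
Hypothesis Eadd : forall n m n0 m0, same_shift n m n0 m0 -> E n - E m = E n0 - E m0.

(* At the largest shift only one pair of points contributes to each of the two
   correlations, so these pairs coincide up to a shift and carry equal values. *)
Lemma extreme_pair (rho1 rho2 x x' x0 x0' : G -> F) (t b : G) :
  (forall n, rho1 n != 0) -> (forall n, rho2 n != 0) ->
  x0 t != 0 -> (forall n, x0 n != 0 -> E n <= E t) ->
  x0' b != 0 -> (forall n, x0' n != 0 -> E b <= E n) ->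
  (forall n m, cross_corr rho1 x x' x0 x0' n m = 0) ->
  (forall n m, cross_corr rho2 x x' x0 x0' n m = 0) ->
  (exists n, (x n != 0) || (x' n != 0)) ->
  exists T B : G, [/\ [/\ x T != 0, forall n, x n != 0 -> E n <= E T,
      x' B != 0 & forall n, x' n != 0 -> E B <= E n],
      forall j, (coord T j + coord B j = coord t j + coord b j)%N &
      rho1 T * rho1 B * (rho2 t * rho2 b) = rho2 T * rho2 B * (rho1 t * rho1 b)].
Proof.
move=> r1 r2 x0t x0max x0b x0min S1 S2 xx'.
have sumzero (a c : G -> F) (w : G -> G -> F) (al ga : int) n0 m0 :
    (forall n, a n != 0 -> E n <= al) -> (forall n, c n != 0 -> ga <= E n) ->
    al - ga < E n0 - E m0 ->
    \sum_(p : G * G | same_shift p.1 p.2 n0 m0) w p.1 p.2 * a p.1 * c p.2 = 0.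
  move=> amax cmin h; rewrite big1// => -[n m] /= /Eadd hE.
  have [->|/amax an] := eqVneq (a n) 0; first by rewrite mulr0 mul0r.
  have [->|/cmin cm] := eqVneq (c m) 0; first by rewrite mulr0.
  lia.
have sumone (a c : G -> F) (w : G -> G -> F) A B n0 m0 :
    (forall n, a n != 0 -> E n <= E A) -> (forall n, c n != 0 -> E B <= E n) ->
    E A - E B = E n0 - E m0 ->
    \sum_(p : G * G | same_shift p.1 p.2 n0 m0) w p.1 p.2 * a p.1 * c p.2 =
    if same_shift A B n0 m0 then w A B * a A * c B else 0.
  move=> amax cmin hE.
  apply: (@sum_single _ _ _ _ (fun n m => w n m * a n * c m)) => n m /Eadd h.
  rewrite !mulf_eq0 !negb_or => /andP[/andP[_ /amax an] /cmin cm].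
  by split; apply: Einj; lia.
have swap rho n0 m0 : \sum_(p : G * G | same_shift p.1 p.2 n0 m0)
    rho p.1 / rho p.2 * x' p.2 * x0 p.1 =
    \sum_(p : G * G | same_shift p.1 p.2 n0 m0)
    (fun n m => rho n / rho m) p.1 p.2 * x0 p.1 * x' p.2.
  by apply: eq_bigr => p _; rewrite mulrAC.
(* If [x] vanished, the correlation at shift [t - B], with [B] the bottom of [x'], would consist of
   one nonzero term. The case of [x'] is symmetric. *)
have x_n0 : exists n, x n != 0.
  apply: contrapT => /forallNP nx.
  have x_0 n : x n = 0 by apply/eqP; apply: contraT => h; case: (nx n).
  have [n1 hn1] : exists n, x' n != 0.
    by case: xx' => n; rewrite x_0 eqxx => h; exists n.
  pose B := [arg min_(i < n1 | x' i != 0) E i]%O.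
  have [x'B Bmin] : x' B != 0 /\ forall n, x' n != 0 -> E B <= E n.
    by rewrite /B; case: arg_minP => // i hi h; split => // n; exact: h.
  move: (S1 t B); rewrite cross_corr_split big1; last first.
    by move=> p _; rewrite x_0 mulr0 mul0r.
  rewrite swap (sumone _ _ (fun n m => rho1 n / rho1 m) t B)//.
  rewrite same_shift_refl sub0r => /eqP; rewrite oppr_eq0 !mulf_eq0 invr_eq0.
  by rewrite !(negPf (r1 _)) (negPf x0t) (negPf x'B).
have x'_n0 : exists n, x' n != 0.
  apply: contrapT => /forallNP nx.
  have x_0 n : x' n = 0 by apply/eqP; apply: contraT => h; case: (nx n).
  have [n1 hn1] := x_n0.
  pose A := [arg max_(i > n1 | x i != 0) E i]%O.
  have [xA Amax] : x A != 0 /\ forall n, x n != 0 -> E n <= E A.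
    by rewrite /A; case: arg_maxP => // i hi h; split => // n; exact: h.
  move: (S1 A b); rewrite cross_corr_split [X in _ - X]big1; last first.
    by move=> p _; rewrite x_0 mulr0 mul0r.
  rewrite (sumone _ _ (fun n m => rho1 n / rho1 m) A b)//.
  rewrite same_shift_refl subr0 => /eqP; rewrite !mulf_eq0 invr_eq0.
  by rewrite !(negPf (r1 _)) (negPf xA) (negPf x0b).
have [n1 hn1] := x_n0; have [n2 hn2] := x'_n0.
pose T := [arg max_(i > n1 | x i != 0) E i]%O.
have [xT Tmax] : x T != 0 /\ forall n, x n != 0 -> E n <= E T.
  by rewrite /T; case: arg_maxP => // i hi h; split => // n; exact: h.
pose B := [arg min_(i < n2 | x' i != 0) E i]%O.
have [x'B Bmin] : x' B != 0 /\ forall n, x' n != 0 -> E B <= E n.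
  by rewrite /B; case: arg_minP => // i hi h; split => // n; exact: h.
(* The largest shift of the first sum is [T - b], that of the second [t - B]. The sums cancel, so
   neither shift can exceed the other, and the two extreme terms are equal. *)
have key rho : (forall n, rho n != 0) ->
    (forall n m, cross_corr rho x x' x0 x0' n m = 0) ->
    same_shift t B T b /\
    rho T / rho b * x T * x0' b = rho t / rho B * x0 t * x' B.
  move=> r S.
  have e1 := S T b; have e2 := S t B.
  rewrite !cross_corr_split !swap in e1 e2.
  rewrite (sumone _ _ (fun n m => rho n / rho m) T b)// same_shift_refl in e1.
  rewrite (sumone _ _ (fun n m => rho n / rho m) t B _ _ x0max Bmin)// in e2.
  rewrite same_shift_refl in e2.
  have nz1 : rho T / rho b * x T * x0' b != 0.
    by rewrite !mulf_neq0 ?invr_neq0.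
  have nz2 : rho t / rho B * x0 t * x' B != 0.
    by rewrite !mulf_neq0 ?invr_neq0.
  have eE : E t - E B = E T - E b.
    case: (ltgtP (E t - E B) (E T - E b)) => // h.
      move: e1; rewrite (sumzero _ _ (fun n m => rho n / rho m) _ _ _ _ x0max Bmin h).
      by rewrite subr0 => /eqP; rewrite (negPf nz1).
    move: e2; rewrite (sumzero _ _ (fun n m => rho n / rho m) _ _ _ _ Tmax x0min h).
    by rewrite sub0r => /eqP; rewrite oppr_eq0 (negPf nz2).
  move: e1; rewrite (sumone _ _ (fun n m => rho n / rho m) t B _ _ x0max Bmin)//.
  case: ifP => _ /eqP; last by rewrite subr0 (negPf nz1).
  by rewrite subr_eq0 => /eqP.
have [h1 e1] := key rho1 r1 S1.
have [_ e2] := key rho2 r2 S2.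
exists T, B; split => //.
  by move=> j; have /same_shiftP/(_ j) := h1; lia.
have {}e1 : rho1 T * rho1 B * (x T * x0' b) = rho1 t * rho1 b * (x0 t * x' B).
  have := congr1 (fun z => z * (rho1 b * rho1 B)) e1 => h.
  transitivity (rho1 T / rho1 b * x T * x0' b * (rho1 b * rho1 B)).
    by field.
  by rewrite h; field.
have {}e2 : rho2 T * rho2 B * (x T * x0' b) = rho2 t * rho2 b * (x0 t * x' B).
  have := congr1 (fun z => z * (rho2 b * rho2 B)) e2 => h.
  transitivity (rho2 T / rho2 b * x T * x0' b * (rho2 b * rho2 B)).
    by field.
  by rewrite h; field.
(* Multiplying the relations for the two masks crosswise eliminates the unknown values, leaving a
   relation between the masks alone. *)
have nz : x T * x0' b != 0 by rewrite mulf_neq0.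
apply: (mulfI nz).
transitivity (rho1 T * rho1 B * (x T * x0' b) * (rho2 t * rho2 b)); first by ring.
rewrite e1.
transitivity (rho2 T * rho2 B * (x T * x0' b) * (rho1 t * rho1 b)); last by ring.
by rewrite e2; ring.
Qed.

End Extreme.
End CrossCorrelation.

(** * An injective additive functional on the grid, and uniqueness of the correlations *)

Lemma radix_inj (B d : nat) (f g : 'I_d -> nat) :
  (forall j, f j < B)%N -> (forall j, g j < B)%N ->
  (\sum_j f j * B ^ j = \sum_j g j * B ^ j)%N -> f =1 g.
Proof.
elim: d f g => [f g _ _ _ [] //|d IH f g fB gB].
rewrite !big_ord_recl !expn0 !muln1.
have tailE (h : 'I_d.+1 -> nat) : (\sum_(i < d) h (lift ord0 i) * B ^ lift ord0 i
    = (\sum_(i < d) h (lift ord0 i) * B ^ i) * B)%N.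
  by rewrite big_distrl; apply: eq_bigr => i _; rewrite /= expnSr mulnA.
rewrite !tailE => e.
have B0 : (0 < B)%N by apply: leq_ltn_trans (fB ord0).
have e0 : f ord0 = g ord0.
  have := congr1 (modn^~ B) e; rewrite ![(_ + _ * B)%N]addnC !modnMDl.
  by rewrite !modn_small.
have e1 : (\sum_(i < d) f (lift ord0 i) * B ^ i = \sum_(i < d) g (lift ord0 i) * B ^ i)%N.
  apply/eqP; rewrite -(eqn_pmul2r B0); apply/eqP.
  by move: e; rewrite e0 => /addnI.
move=> j; have [i ->|->//] := unliftP ord0 j.
by apply: (IH (fun i => f (lift ord0 i)) (fun i => g (lift ord0 i))) => // k.
Qed.

(** A grid point is read as the digits of a number in a base larger than every coordinate: linearity
    gives additivity, uniqueness of digits gives injectivity. *)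
Lemma additive_order (d : nat) (M : 'I_d -> nat) : exists E : grid M -> int,
  injective E /\ forall n m n0 m0, same_shift n m n0 m0 -> E n - E m = E n0 - E m0.
Proof.
pose B := (\sum_j M j).+1.
pose e (n : grid M) := (\sum_j coord n j * B ^ j)%N.
exists (fun n => Posz (e n)); split => [n m [h]|n m n0 m0 /same_shiftP h].
  have cB (k : grid M) j : (coord k j < B)%N.
    by rewrite /B ltnS (leq_trans (leq_ord (k j)))// (bigD1 j)//= leq_addr.
  by apply: coord_inj; apply: (radix_inj (cB n) (cB m) h).
suff : (e n + e m0 = e n0 + e m)%N by lia.
rewrite /e -!big_split /=; apply: eq_bigr => j _.
by rewrite -!mulnDl h.
Qed.

Section UniqueCorrelations.
Variables (F : fieldType) (d : nat) (M : 'I_d -> nat).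
Local Notation G := (grid M).

(** Subtracting the multiple of [x0] that agrees with [x] at the top [t] leaves a solution [u],
    [u']. If nonzero it would live at the single points [b] and [t] respectively, and testing it
    against a third support point [p] gives a contradiction. *)
Lemma cross_corr_unique (rho1 rho2 x x' x0 x0' : G -> F) :
  (forall n, rho1 n != 0) -> (forall n, rho2 n != 0) ->
  (forall n, (x0' n == 0) = (x0 n == 0)) ->
  (forall t b, exists p, [/\ x0 p != 0, p != t & p != b]) ->
  (forall p q m m', p != q -> p != m -> p != m' ->
    rho1 p * rho1 q * (rho2 m * rho2 m') <> rho1 m * rho1 m' * (rho2 p * rho2 q)) ->
  (forall n m, cross_corr rho1 x x' x0 x0' n m = 0) ->
  (forall n m, cross_corr rho2 x x' x0 x0' n m = 0) ->
  exists a, forall n, x n = a * x0 n /\ x' n = a * x0' n.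
Proof.
move=> r1 r2 x0E third gen S1 S2.
have [E [Einj Eadd]] := additive_order M.
have [n1 x0n1] : exists n, x0 n != 0.
  pose z : G := [ffun j => ord0].
  by have [p []] := third z z; exists p.
pose t := [arg max_(i > n1 | x0 i != 0) E i]%O.
have [x0t tmax] : x0 t != 0 /\ forall n, x0 n != 0 -> E n <= E t.
  by rewrite /t; case: arg_maxP => // i hi h; split => // n; exact: h.
pose b := [arg min_(i < n1 | x0 i != 0) E i]%O.
have [x0b bmin] : x0 b != 0 /\ forall n, x0 n != 0 -> E b <= E n.
  by rewrite /b; case: arg_minP => // i hi h; split => // n; exact: h.
have [p [x0p pt pb]] := third t b.
have tb : t != b.
  apply: contraNneq pt => tb.
  by apply/eqP/Einj/eqP; rewrite eq_le tmax//= tb bmin.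
(* Genericity applied to the pair [t], [b]: the masks can agree with another pair only if it
   contains [t]. *)
have {}gen m m' : (forall j, coord m j + coord m' j = coord t j + coord b j)%N ->
    rho1 m * rho1 m' * (rho2 t * rho2 b) = rho2 m * rho2 m' * (rho1 t * rho1 b) ->
    m = t \/ m' = t.
  move=> _ h; have [->|mt] := eqVneq m t; first by left.
  have [->|m't] := eqVneq m' t; first by right.
  case: (gen t b m m' tb); [by rewrite eq_sym|by rewrite eq_sym|].
  by rewrite h mulrC.
(* The solution [x - a * x0] vanishes at [t], so its top is [b] and the bottom
   of its companion is [t]; the opposite order pins down the other two ends. *)
exists (x t / x0 t).
set a := x t / x0 t.
pose u n := x n - a * x0 n; pose u' n := x' n - a * x0' n.
suff uu n : u n = 0 /\ u' n = 0.
  by move=> n; have [/subr0_eq -> /subr0_eq ->] := uu n.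
have ut : u t = 0 by rewrite /u /a divfK// subrr.
have Su rho : (forall n m, cross_corr rho x x' x0 x0' n m = 0) ->
    forall n m, cross_corr rho u u' x0 x0' n m = 0.
  by move=> S i j; rewrite cross_corrB S cross_corr_self mulr0 subrr.
have Su1 := Su _ S1; have Su2 := Su _ S2.
suff : ~ exists n, (u n != 0) || (u' n != 0).
  move/forallNP => /(_ n)/negP; rewrite negb_or !negbK => /andP[/eqP ? /eqP ?].
  by split.
move=> uu0.
have x0b' : x0' b != 0 by rewrite x0E.
have x0t' : x0' t != 0 by rewrite x0E.
have bmin' n0 : x0' n0 != 0 -> E b <= E n0 by rewrite x0E; exact: bmin.
have tmax' n0 : x0' n0 != 0 -> - E t <= - E n0.
  by rewrite x0E lerN2; exact: tmax.
have NEinj : injective (fun n => - E n) by move=> i j /oppr_inj/Einj.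
have NEadd i j k l : same_shift i j k l -> - E i - - E j = - E k - - E l.
  by move=> /Eadd h; rewrite -!opprD h.
have bmin'' n0 : x0 n0 != 0 -> - E n0 <= - E b by rewrite lerN2; exact: bmin.
have [T [B [[uT umax u'B u'min] TB e]]] :=
  extreme_pair Einj Eadd r1 r2 x0t tmax x0b' bmin' Su1 Su2 uu0.
have [T2 [B2 [[uT2 umax2 u'B2 u'min2] TB2 e2]]] :=
  extreme_pair NEinj NEadd r1 r2 x0b bmin'' x0t' tmax' Su1 Su2 uu0.
have end_eq C D : u C != 0 ->
    (forall j, coord C j + coord D j = coord t j + coord b j)%N ->
    rho1 C * rho1 D * (rho2 t * rho2 b) = rho2 C * rho2 D * (rho1 t * rho1 b) ->
    C = b /\ D = t.
  move=> uC CD eC.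
  have [Ct|Dt] := gen C D CD eC; first by rewrite Ct ut eqxx in uC.
  split => //; apply: coord_inj => j; by have := CD j; rewrite Dt addnC => /addnI.
have [Tb Bt] := end_eq T B uT TB e.
have [T2b B2t] : T2 = b /\ B2 = t.
  apply: (end_eq T2 B2 uT2).
    by move=> j; rewrite TB2 addnC.
  by rewrite [rho2 t * _]mulrC e2 [rho1 b * _]mulrC.
have suppu n0 : u n0 != 0 -> n0 = b.
  move=> h; apply: Einj; apply/eqP; rewrite eq_le -{1}Tb umax//=.
  by have := umax2 _ h; rewrite T2b lerN2.
have suppu' n0 : u' n0 != 0 -> n0 = t.
  move=> h; apply: Einj; apply/eqP; rewrite eq_le -{2}Bt u'min//= andbT.
  by have := u'min2 _ h; rewrite B2t lerN2.
have ub : u b != 0 by rewrite -Tb.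
have u't : u' t != 0 by rewrite -Bt.
have x0p' : x0' p != 0 by rewrite x0E.
(* The correlation is tested at the shift [b - p]. Given the supports of [u] and [u'], only the
   pairs [(b, p)] and [(q, t)] with [q = t + b - p] can contribute, and the first contribution is
   nonzero. *)
have first_sum (rho : G -> F) : \sum_(k : G * G | same_shift k.1 k.2 b p)
    rho k.1 / rho k.2 * u k.1 * x0' k.2 = rho b / rho p * u b * x0' p.
  rewrite (@sum_single _ _ _ b p b p (fun n m => rho n / rho m * u n * x0' m)).
    by rewrite same_shift_refl.
  move=> i j /same_shiftP hij; rewrite !mulf_eq0 !negb_or.
  move=> /andP[/andP[_ /suppu ib] _]; split => //; apply: coord_inj => k.
  by have := hij k; rewrite ib => /addnI.
have [[q hq]|noq] := pselect (exists q : G, forall j,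
    (coord q j + coord p j = coord t j + coord b j)%N); last first.
  move: (Su1 b p); rewrite cross_corr_split first_sum [X in _ - X]big1.
    rewrite subr0 => /eqP; rewrite !mulf_eq0 invr_eq0 !(negPf (r1 _)).
    by rewrite (negPf ub) (negPf x0p').
  move=> [i j] /= /same_shiftP hij; apply/eqP; apply: contraT.
  rewrite !mulf_eq0 !negb_or => /andP[/andP[_ /suppu' jt] _].
  by case: noq; exists i => k; rewrite hij jt addnC.
have key (rho : G -> F) : (forall n, rho n != 0) ->
    (forall n m, cross_corr rho u u' x0 x0' n m = 0) ->
    rho b * rho t * (u b * x0' p) = rho q * rho p * (u' t * x0 q).
  move=> r S; move: (S b p); rewrite cross_corr_split first_sum.
  rewrite (@sum_single _ _ _ b p q t (fun n m => rho n / rho m * u' m * x0 n)).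
    have -> : same_shift q t b p by apply/same_shiftP => j; rewrite hq addnC.
    move/subr0_eq => h; transitivity (rho b / rho p * u b * x0' p * (rho p * rho t)).
      by field.
    by rewrite h; field.
  move=> i j /same_shiftP hij; rewrite !mulf_eq0 !negb_or.
  move=> /andP[/andP[_ /suppu' jt] _]; split => //; apply: coord_inj => k.
  by have := hij k; rewrite jt [(coord b k + _)%N]addnC -hq => /addIn.
have k1 := key _ r1 Su1; have k2 := key _ r2 Su2.
have nzX : u b * x0' p != 0 by rewrite mulf_neq0.
have nzY : u' t * x0 q != 0.
  apply/eqP => Y0; move: k1; rewrite Y0 mulr0 => /eqP.
  by rewrite !mulf_eq0 !(negPf (r1 _)) (negPf ub) (negPf x0p').
(* The unknown factors are the same for both masks, so they cancel and genericity puts [t] in the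
   pair [{q, p}]; either case contradicts the choice of [p]. *)
have [qt|pt'] : q = t \/ p = t.
- apply: gen => //; apply: (mulfI nzX); apply: (mulfI nzY).
  transitivity (rho1 q * rho1 p * (u' t * x0 q) * (rho2 b * rho2 t * (u b * x0' p))).
    by ring.
  by rewrite -k1 k2; ring.
- case/eqP: pb; apply: coord_inj => j; by have := hq j; rewrite qt => /addnI.
- by rewrite pt' eqxx in pt.
Qed.
End UniqueCorrelations.

(** * Inversion of the oversampled Fourier transform *)

Lemma expi_2pi_nat (R : realType) (n : nat) : expi (2 * pi * n%:R : R) = 1.
Proof.
elim: n => [|n IH]; first by rewrite mulr0 expi0.
rewrite -(natr1 n) mulrDr mulr1 expiD IH mul1r /expi.
by rewrite [2 * pi]mulrC mulr_natr cos2pi sin2pi.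
Qed.

Lemma expi_2pi_diff (R : realType) (p q : nat) :
  expi (2 * pi * (p%:R - q%:R) : R) = 1.
Proof.
have := expiVE (2 * pi * q%:R : R); rewrite expi_2pi_nat mul1r => h.
by rewrite mulrBr expiD expi_2pi_nat mul1r.
Qed.

Section Fourier.
Variables (R : realType) (d : nat) (M : 'I_d -> nat).
Implicit Types (n m : grid M) (w : freqs M).

Definition angle w n : R :=
  \sum_(j < d) (coord n j)%:R * ((coord w j)%:R / (M j).*2.+1%:R).

(** Orthogonality of characters of a product of cyclic groups of orders [2 M_j + 1]. If the shifts
    differ in direction [j], rotating that frequency coordinate multiplies each term by one fixed
    [zeta != 1], so the sum vanishes. *)
Lemma sum_characters n m n0 m0 :
  \sum_w expi (2 * pi * (angle w n0 - angle w m0 - angle w n + angle w m)) =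
  if same_shift n m n0 m0 then #|freqs M|%:R else 0.
Proof.
case: ifPn => [/same_shiftP h|].
  rewrite (eq_bigr (fun=> 1)); first by rewrite sumr_const.
  move=> w _; rewrite (_ : _ - _ - _ + _ = 0) ?mulr0 ?expi0//.
  suff e : angle w n0 + angle w m = angle w n + angle w m0.
    transitivity (angle w n0 + angle w m - (angle w n + angle w m0)); first by ring.
    by rewrite e subrr.
  by rewrite /angle -!big_split; apply: eq_bigr => j _ /=; rewrite -!mulrDl -!natrD h.
rewrite negb_forall => /existsP[j hj].
pose D := (M j).*2.+1.
pose shift w : freqs M := finfun (fun i : 'I_d =>
  (if i == j then ordS ((w : {dffun forall j : 'I_d, 'I_((M j).*2).+1}) i)
   else (w : {dffun forall j : 'I_d, 'I_((M j).*2).+1}) i) : 'I_((M i).*2).+1).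
have shift_inj : injective shift.
  move=> v w /ffunP vw; apply/ffunP => i; have := vw i; rewrite !ffunE.
  by case: ifP => // _ /ordS_inj.
pose A w := angle w n0 - angle w m0 - angle w n + angle w m.
pose de : R := (coord n0 j + coord m j)%:R - (coord m0 j + coord n j)%:R.
pose zeta := expi (2 * pi * (de / D%:R)).
have D0 : D%:R != 0 :> R by rewrite pnatr_eq0.
(* The quotient is [1] exactly when the rotation wraps around; it contributes an integer, which the
   exponential ignores. *)
have angleS w k : angle (shift w) k = angle w k + (coord k j)%:R *
    (D%:R^-1 - ((coord w j).+1 %/ D)%:R).
  rewrite /angle (bigD1 j)//= [in RHS](bigD1 j)//=.
  have -> : coord (shift w) j = ((coord w j).+1 %% D)%N.
    by rewrite /coord ffunE eqxx.
  rewrite [X in _ + X = _](eq_bigr (fun i => (coord k i)%:R *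
      ((coord w i)%:R / (M i).*2.+1%:R))); last first.
    by move=> i /negPf ij; rewrite /coord ffunE ij.
  have := congr1 (fun z => z%:R : R) (divn_eq (coord w j).+1 D).
  rewrite natrD natrM -(natr1 (coord w j)) => h.
  have {h} -> : ((coord w j).+1 %% D)%:R = (coord w j)%:R + 1 -
      ((coord w j).+1 %/ D)%:R * D%:R :> R by rewrite h; ring.
  rewrite -/D; field.
  exact: D0.
have AS w : expi (2 * pi * A (shift w)) = zeta * expi (2 * pi * A w).
  rewrite /A !angleS /zeta.
  set q := ((coord w j).+1 %/ D)%N.
  transitivity (expi (2 * pi * (de / D%:R)) * expi (2 * pi * A w) *
    expi (2 * pi * (((coord m0 j + coord n j) * q)%:R -
                     ((coord n0 j + coord m j) * q)%:R))); last first.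
    by rewrite expi_2pi_diff mulr1.
  rewrite -!expiD; congr expi; rewrite /A /de !natrM !natrD.
  by ring.
(* The difference of the two shifts is nonzero and at most [2 M_j] in absolute value, hence no
   multiple of [2 M_j + 1]. This is what the oversampling provides. *)
have zeta1 : zeta != 1.
  apply/eqP; rewrite -(@expi0 R) => /expi_eq[k]; rewrite add0r => kE.
  have p2 : 2 * pi != 0 :> R by rewrite mulf_neq0 ?pnatr_eq0// gt_eqF ?pi_gt0.
  move: kE => /(mulfI p2) /(congr1 (fun z => z * D%:R)); rewrite divfK// /de => h.
  have {}h : (coord n0 j + coord m j)%:Z - (coord m0 j + coord n j)%:Z = k * D%:Z.
    by apply: (@intr_inj R); rewrite rmorphB rmorphM /= -!pmulrn.
  have bd (i : grid M) : (coord i j <= M j)%N by rewrite -ltnS /coord ltn_ord.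
  have := bd n; have := bd m; have := bd n0; have := bd m0.
  move: hj h; rewrite /D; move: (coord n j) (coord m j) (coord n0 j) (coord m0 j).
  move: (M j) => N a b c e /eqP hne kE eN cN bN aN.
  have : (k == 0) || (1 <= `|k|) by lia.
  case/orP => [/eqP k0|k1]; first by move: kE; rewrite k0 mul0r; lia.
  have : `|k| * N.*2.+1%:Z <= N.*2%:Z.
    by rewrite -[N.*2.+1%:Z]gtr0_norm// -normrM -kE; lia.
  have : 1 * N.*2.+1%:Z <= `|k| * N.*2.+1%:Z by rewrite ler_wpM2r.
  lia.
apply/eqP; have : (1 - zeta) * \sum_w expi (2 * pi * A w) == 0.
  rewrite mulrBl mul1r subr_eq0 mulr_sumr; apply/eqP.
  rewrite (reindex_inj shift_inj) /=; apply: eq_bigr => w _; exact: AS.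
by rewrite mulf_eq0 subr_eq0 eq_sym (negPf zeta1).
Qed.

(** A product that is real at every frequency equals its conjugate; their difference is a
    trigonometric polynomial vanishing on the lattice, and its coefficients are the sums over pairs
    with a fixed shift. *)
Lemma fourier_real_cross (f g : grid M -> R[i]) :
  (forall w, complex.Im ((\sum_n expi (- (2 * pi * angle w n)) * f n) *
     Num.conj (\sum_n expi (- (2 * pi * angle w n)) * g n)) = 0) ->
  forall n0 m0, \sum_(p : grid M * grid M | same_shift p.1 p.2 n0 m0)
    (f p.1 * Num.conj (g p.2) - Num.conj (f p.2) * g p.1) = 0.
Proof.
move=> h n0 m0.
pose H (p : grid M * grid M) := f p.1 * Num.conj (g p.2) - Num.conj (f p.2) * g p.1.
have hw w : \sum_(p : grid M * grid M)
    expi (2 * pi * (- angle w p.1 + angle w p.2)) * H p = 0.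
  have := h w; set z := _ * Num.conj _ => z0.
  have : z - Num.conj z = 0 by rewrite -[Num.conj z]/(conjc z) subcJ z0 mulr0 mul0r.
  rewrite /z rmorphM /= conjCK !rmorph_sum /= => hz.
  rewrite -[RHS]hz [X in _ = _ - X]mulrC.
  rewrite !big_distrlr /= !pair_big /= -sumrB; apply: eq_bigr => -[n m] _ /=.
  rewrite !rmorphM /= -!expiN opprK /H /= [2 * pi * (_ + _)]mulrDr expiD mulrN.
  by ring.
(* Multiplying by the character of the shift [n0 - m0] and summing over the lattice isolates the
   pairs with this shift. *)
have : \sum_w expi (2 * pi * (angle w n0 - angle w m0)) *
   \sum_(p : grid M * grid M) expi (2 * pi * (- angle w p.1 + angle w p.2)) * H p = 0.
  by rewrite big1// => w _; rewrite hw mulr0.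
under eq_bigr do rewrite mulr_sumr.
rewrite exchange_big /=.
rewrite (eq_bigr (fun p => (if same_shift p.1 p.2 n0 m0 then #|freqs M|%:R else 0) * H p)).
  rewrite (bigID (fun p => same_shift p.1 p.2 n0 m0))/= [X in _ + X]big1 ?addr0; last first.
    by move=> p /negPf ->; rewrite mul0r.
  rewrite (eq_bigr (fun p => #|freqs M|%:R * H p)); last by move=> p ->.
  have c0 : (#|freqs M| == 0)%N = false.
    apply/negbTE; rewrite -lt0n; apply/card_gt0P.
    by exists (finfun (fun i => ord0)).
  by rewrite -mulr_sumr => /eqP; rewrite mulf_eq0 pnatr_eq0 c0 => /eqP.
move=> p _; rewrite -sum_characters mulr_suml; apply: eq_bigr => w _.
rewrite mulrA -expiD; congr (expi _ * _).
by ring.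
Qed.
End Fourier.

(** A support contained in two points lies on a line, and so does its convex hull; the matrix of
    differences is then a column times a row and cannot have rank two. *)
Lemma rank_ge2_third_point (R : realType) (d : nat) (M : 'I_d -> nat)
    (x0 : object R M) : rank_ge2 x0 ->
  forall t b : grid M, exists p, [/\ x0 (enum_rank p) 0 != 0, p != t & p != b].
Proof.
move=> [p [pK pfree]] t b; apply: contrapT => /forallNP nop.
pose pt (n : grid M) : 'rV[R]_d := \row_j (coord n j)%:R.
pose v := pt b - pt t.
have onS q : support_pts x0 q -> exists s : R, q = pt t + s *: v.
  move=> [n nS <-].
  have [nt|nt] := eqVneq (enum_val n) t.
    by exists 0; rewrite scale0r addr0 /pt nt.
  have [nb|nb] := eqVneq (enum_val n) b.
    by exists 1; rewrite scale1r addrC subrK /pt nb.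
  by case: (nop (enum_val n)); split => //; rewrite enum_valK.
have onK k : exists s : R, p k = pt t + s *: v.
  have [m [a [q [_ a1 qS ->]]]] := pK k.
  have /choice[s sE] i := onS _ (qS i).
  exists (\sum_i a i * s i).
  under eq_bigr do rewrite sE scalerDr scalerA.
  by rewrite big_split /= -!scaler_suml a1 scale1r.
have [s sE] := choice onK.
move: pfree; rewrite /row_free => /eqP.
have -> : \matrix_(i < 2) (p (lift ord0 i) - p ord0) =
    (\col_(i < 2) (s (lift ord0 i) - s ord0)) *m v.
  apply/matrixP => i j; rewrite !mxE big_ord1 !mxE !sE !mxE.
  by ring.
move=> h; have := mulmx_max_rank (\col_(i < 2) (s (lift ord0 i) - s ord0)) v.
by rewrite h.
Qed.

(** * Uniqueness up to a real factor for two generic masks *)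

Section MaskUniqueness.
Variables (R : realType) (d : nat) (M : 'I_d -> nat) (l : nat).
Variables (c : R[i]) (mu : 'I_l -> grid M -> R[i]).

Lemma AstarE (x : object R M) (j : 'I_l) (w : 'I_#|freqs M|) :
  (Astar c mu *m x) (tagnat.Rank j w) 0 =
  c * \sum_n expi (- (2 * pi * angle R (enum_val w) n)) *
    (mu j n * x (enum_rank n) 0).
Proof.
rewrite /Astar -scalemxAl mxE; congr (_ * _).
have -> : ((\mxcol_(j < l) (dft R M *m diag_mx (\row_n mu j (enum_val n)))) *m x)
    (tagnat.Rank j w) 0 = submxcol ((\mxcol_(j < l) (dft R M *m
      diag_mx (\row_n mu j (enum_val n)))) *m x) j w 0.
  by rewrite /submxcol [RHS]mxE.
rewrite -submxcol_mul mxcolK -mulmxA mxE.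
rewrite [RHS](reindex (@enum_val _ (grid M))) /=; last first.
  by apply: onW_bij; exact: enum_val_bij.
apply: eq_bigr => n _; rewrite mul_diag_mx !mxE enum_valK.
by [].
Qed.

Lemma mask_uniqueness (x0 : object R M) (j0 j1 : 'I_l) :
  c != 0 -> (forall j n, Num.conj (mu j n) = (mu j n)^-1) ->
  (forall j n, mu j n != 0) -> rank_ge2 x0 ->
  (forall p q m m', p != q -> p != m -> p != m' ->
    mu j0 p * mu j0 q * (mu j1 m * mu j1 m') <>
    mu j0 m * mu j0 m' * (mu j1 p * mu j1 q)) ->
  forall x : object R M,
  (forall i, complex.Im ((Astar c mu *m x) i 0 *
     Num.conj ((Astar c mu *m x0) i 0)) = 0) ->
  exists r : R, x = r%:C *: x0.
Proof.
move=> c0 muV mu0 rk gen x hx.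
pose f (z : object R M) n := z (enum_rank n) 0.
have S j n m : cross_corr (mu j) (f x) (fun n => Num.conj (f x n)) (f x0)
    (fun n => Num.conj (f x0 n)) n m = 0.
  rewrite /cross_corr -[RHS](@fourier_real_cross R d M (fun n => mu j n * f x n)
    (fun n => mu j n * f x0 n) _ n m).
    by apply: eq_bigr => p _; rewrite !rmorphM /= !muV; ring.
  move=> w; have := hx (tagnat.Rank j (enum_rank w)).
  rewrite !AstarE enum_rankK rmorphM mulrACA.
  (* The constant enters only through the positive real factor [|c|^2], which does not affect the
     vanishing of the imaginary part. *)
  rewrite (_ : c * Num.conj c = (complex.Re c ^+ 2 + complex.Im c ^+ 2)%:C); last first.
    by rewrite add_Re2_Im2 sqr_normc.
  set z := _ * Num.conj _.
  rewrite -[X in complex.Im X = _ -> _]/(_ *: z).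
  have -> (r : R) : complex.Im (r%:C * z) = r * complex.Im z.
    by case: z => a b /=; rewrite mul0r addr0.
  move/eqP; rewrite mulf_eq0 => /orP[|/eqP//].
  rewrite paddr_eq0 ?sqr_ge0// !sqrf_eq0 => cc.
  by case/negP: c0; rewrite eq_complex.
have [a ha] := cross_corr_unique (mu0 j0) (mu0 j1)
  (fun n => fmorph_eq0 _ (f x0 n)) (rank_ge2_third_point rk) gen (S j0) (S j1).
have xE : x = a *: x0.
  apply/colP => n; have := (ha (enum_val n)).1; rewrite /f enum_valK !mxE => ->.
  by [].
(* The same [a] relates the conjugates of [x] and [x0], so it equals its own conjugate. *)
exists (complex.Re a); rewrite xE; congr (_ *: _).
have z0 : grid M by exact: [ffun j => ord0].
have [p [x0p _ _]] := rank_ge2_third_point rk z0 z0.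
have [e1 e2] := ha p; move: e2; rewrite e1 rmorphM.
have nz : Num.conj (f x0 p) != 0 by rewrite fmorph_eq0.
move=> /(mulIf nz) /(congr1 (@complex.Im R)) ima.
apply/eqP; rewrite eq_complex eqxx /=; apply/eqP.
by move: ima; case: (a) => u v /=; lra.
Qed.
End MaskUniqueness.

(** * Douglas-Rachford iteration of two real projections *)

(* Both are locked: [ring] and [lra] compare atoms up to unfolding. *)
HB.lock Definition rdot (R : realType) (m : nat) (u v : 'cV[R[i]]_m) : R :=
  complex.Re ((v^t* *m u) 0 0).

HB.lock Definition vnorm (R : realType) (m : nat) (u : 'cV[R[i]]_m) : R := norm2 u.

Section RealInner.
Variable R : realType.
Local Notation C := R[i].

Lemma ReD (a b : C) : complex.Re (a + b) = complex.Re a + complex.Re b.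
Proof. by case: a; case: b. Qed.

Lemma ReN (a : C) : complex.Re (- a) = - complex.Re a.
Proof. by case: a. Qed.

Lemma Re_realM (r : R) (a : C) : complex.Re (r%:C * a) = r * complex.Re a.
Proof. by case: a => x y /=; rewrite mul0r subr0. Qed.

Lemma Re_mul_conj (a b : C) : complex.Re (a * Num.conj b) =
  complex.Re a * complex.Re b + complex.Im a * complex.Im b.
Proof. by case: a b => x y [u v] /=; rewrite mulrN opprK. Qed.

Section Vec.
Variable m : nat.
Implicit Types u v w : 'cV[C]_m.

Lemma rdotE u v : rdot u v = \sum_i complex.Re (u i 0 * Num.conj (v i 0)).
Proof.
rewrite rdot.unlock mxE; elim/big_ind2: _ => //.
  by move=> x1 x2 y1 y2 <- <-; rewrite ReD.
by move=> i _; rewrite !mxE mulrC.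
Qed.

Lemma rdotC u v : rdot u v = rdot v u.
Proof.
rewrite !rdotE; apply: eq_bigr => i _.
by rewrite !Re_mul_conj; ring.
Qed.

Lemma rdotDl u v w : rdot (u + v) w = rdot u w + rdot v w.
Proof. by rewrite rdot.unlock mulmxDr mxE ReD. Qed.

Lemma rdotNl u w : rdot (- u) w = - rdot u w.
Proof. by rewrite rdot.unlock mulmxN mxE ReN. Qed.

Lemma rdotBl u v w : rdot (u - v) w = rdot u w - rdot v w.
Proof. by rewrite rdotDl rdotNl. Qed.

Lemma rdotZl r u w : rdot (r%:C *: u) w = r * rdot u w.
Proof. by rewrite rdot.unlock -scalemxAr mxE Re_realM. Qed.

Lemma rdotDr u v w : rdot w (u + v) = rdot w u + rdot w v.
Proof. by rewrite ![rdot w _]rdotC rdotDl. Qed.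

Lemma rdotNr u w : rdot w (- u) = - rdot w u.
Proof. by rewrite ![rdot w _]rdotC rdotNl. Qed.

Lemma rdotBr u v w : rdot w (u - v) = rdot w u - rdot w v.
Proof. by rewrite ![rdot w _]rdotC rdotBl. Qed.

Lemma rdotZr r u w : rdot w (r%:C *: u) = r * rdot w u.
Proof. by rewrite ![rdot w _]rdotC rdotZl. Qed.

Lemma rdot0l w : rdot 0 w = 0.
Proof. by rewrite -[X in rdot X]subr0 rdotBl subrr. Qed.

Lemma vnormE u : vnorm u = norm2 u.
Proof. by rewrite vnorm.unlock. Qed.

Lemma vnorm_rdot u : vnorm u = Num.sqrt (rdot u u).
Proof.
rewrite vnormE /norm2 rdotE; congr Num.sqrt; apply: eq_bigr => i _.
by rewrite sqr_normc.
Qed.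

Lemma rdot_ge0 u : 0 <= rdot u u.
Proof.
rewrite rdotE; apply: sumr_ge0 => i _; rewrite Re_mul_conj -!expr2.
by rewrite addr_ge0 ?sqr_ge0.
Qed.

Lemma vnorm_sqr u : vnorm u ^+ 2 = rdot u u.
Proof. by rewrite vnorm_rdot sqr_sqrtr ?rdot_ge0. Qed.

Lemma vnorm_ge0 u : 0 <= vnorm u.
Proof. by rewrite vnorm_rdot sqrtr_ge0. Qed.

End Vec.

Lemma rdot_adj m n (A : 'M[C]_(m, n)) u v : rdot (A *m u) v = rdot u (A^t* *m v).
Proof.
rewrite rdot.unlock; congr (complex.Re (_ 0 0)).
by rewrite trmx_mul map_mxM /= trmxCK mulmxA.
Qed.

Section Vec.
Variable m : nat.
Implicit Types u v w : 'cV[C]_m.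

Lemma rdot_eq0 u : rdot u u = 0 -> u = 0.
Proof.
rewrite rdotE => /eqP; rewrite psumr_eq0; last first.
  by move=> i _; rewrite Re_mul_conj -!expr2 addr_ge0 ?sqr_ge0.
move=> /allP h; apply/colP => i; have := h i (mem_index_enum _).
rewrite /= Re_mul_conj -!expr2 paddr_eq0 ?sqr_ge0// !sqrf_eq0 mxE.
by move=> e; apply/eqP; rewrite eq_complex.
Qed.

Lemma vnorm_le_sqr u v : (vnorm u <= vnorm v) = (rdot u u <= rdot v v).
Proof. by rewrite !vnorm_rdot ler_sqrt ?rdot_ge0. Qed.

Lemma rdot_cauchy u v : rdot u v <= vnorm u * vnorm v.
Proof.
have [->|u0] := eqVneq u 0; first by rewrite rdot0l mulr_ge0 ?vnorm_ge0.
have uu : 0 < rdot u u.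
  rewrite lt_neqAle rdot_ge0 andbT eq_sym; apply: contraNneq u0 => /rdot_eq0 ->.
  exact: eqxx.
have : 0 <= rdot ((rdot u u)%:C *: v - (rdot u v)%:C *: u)
                 ((rdot u u)%:C *: v - (rdot u v)%:C *: u) by exact: rdot_ge0.
rewrite !(rdotBl, rdotBr, rdotZl, rdotZr) [rdot v u]rdotC => h.
have {}h : rdot u v ^+ 2 <= (vnorm u * vnorm v) ^+ 2.
  rewrite exprMn !vnorm_sqr -(ler_pM2l uu).
  by rewrite -subr_ge0; move: h; congr (0 <= _); ring.
apply: le_trans (ler_norm _) _.
by rewrite -(ler_pXn2r (n := 2))// ?nnegrE ?mulr_ge0 ?vnorm_ge0// real_normK ?num_real.
Qed.

Lemma vnormD u v : vnorm (u + v) <= vnorm u + vnorm v.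
Proof.
rewrite -(ler_pXn2r (n := 2))// ?nnegrE ?addr_ge0 ?vnorm_ge0//.
rewrite vnorm_sqr rdotDl !rdotDr sqrrD !vnorm_sqr [rdot v u]rdotC.
have := rdot_cauchy u v; lra.
Qed.

Lemma vnorm_scale (e : C) u : vnorm (e *: u) = normc e * vnorm u.
Proof.
rewrite !vnorm_rdot.
have -> : rdot (e *: u) (e *: u) = normc e ^+ 2 * rdot u u.
  rewrite !rdotE mulr_sumr; apply: eq_bigr => i _; rewrite !mxE rmorphM mulrACA.
  rewrite -sqr_normc -rmorphXn /= Re_realM; congr (_ * _).
rewrite sqrtrM ?sqr_ge0// sqrtr_sqr ger0_norm//.
by rewrite /normc; case: (e) => a b; exact: sqrtr_ge0.
Qed.

Lemma vnormN u : vnorm (- u) = vnorm u.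
Proof. by rewrite !vnorm_rdot rdotNl rdotNr opprK. Qed.

Lemma vnormB u v : vnorm (u - v) <= vnorm u + vnorm v.
Proof. by rewrite -(vnormN v) vnormD. Qed.

End Vec.

(** The range and the kernel of a symmetric real matrix meet only in [0], so squaring keeps the row
    space; [E] inverts [D] on its range. *)
Lemma sym_mul_factor m (D : 'M[R]_m) : D^T = D -> exists E, D = E *m D *m D.
Proof.
move=> DT; suff /submxP[E DE] : (D <= D *m D)%MS by exists E; rewrite -mulmxA -DE.
have DD : (D *m D <= D)%MS by exact: submxMl.
rewrite -(geq_leqif (mxrank_leqif_sup DD)).
have := mxrank_mul_ker D D; suff -> : (D :&: kermx D)%MS = 0.
  by rewrite mxrank0 addn0 => ->.
apply/eqP/rowV0P => v; rewrite sub_capmx => /andP[/submxP[w vE] /sub_kermxP vD].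
have v0 : v *m v^T = 0 by rewrite {2}vE trmx_mul DT mulmxA vD mul0mx.
apply/rowP => j; rewrite mxE; apply/eqP.
have := congr1 (fun A : 'M[R]_1 => A 0 0) v0; rewrite !mxE => /eqP.
rewrite psumr_eq0; last by move=> k _; rewrite mxE -expr2 sqr_ge0.
by move=> /allP/(_ j (mem_index_enum _)); rewrite /= mxE -expr2 sqrf_eq0.
Qed.

Definition realify m (v : 'cV[C]_m) : 'rV[R]_(m + m) :=
  row_mx (\row_i complex.Re (v i 0)) (\row_i complex.Im (v i 0)).

Definition complexify m (v : 'rV[R]_(m + m)) : 'cV[C]_m :=
  \col_i (v 0 (lshift m i) +i* v 0 (rshift m i)).

Lemma realifyK m : cancel (@realify m) (@complexify m).
Proof.
move=> v; apply/colP => i; rewrite mxE /realify row_mxEl row_mxEr !mxE.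
by case: (v i 0).
Qed.

Lemma complexifyK m : cancel (@complexify m) (@realify m).
Proof.
move=> v; apply/rowP => i; rewrite /realify mxE.
by case: splitP => k ik; rewrite !mxE /=; congr (v _ _); apply/val_inj.
Qed.

Lemma rdot_realify m (u v : 'cV[C]_m) :
  rdot u v = (realify u *m (realify v)^T) 0 0.
Proof.
rewrite rdotE /realify tr_row_mx mul_row_col !mxE -big_split /=.
by apply: eq_bigr => i _; rewrite Re_mul_conj !mxE.
Qed.

Lemma mulmx_bound m (E : 'M[R]_m) : exists2 K, 1 <= K & forall u : 'rV[R]_m,
  ((u *m E) *m (u *m E)^T) 0 0 <= K * (u *m u^T) 0 0.
Proof.
(* The summand [1] ensures [K >= 1], so that [1 - K^-1] can later serve as the square of a rate. *)
exists (1 + \sum_j (\sum_i `|E i j|) ^+ 2) => [|u].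
  by rewrite lerDl sumr_ge0// => j _; rewrite sqr_ge0.
have dotE (w : 'rV[R]_m) : (w *m w^T) 0 0 = \sum_i w 0 i ^+ 2.
  by rewrite mxE; apply: eq_bigr => i _; rewrite mxE expr2.
rewrite !dotE; set s := \sum_i u 0 i ^+ 2.
have s0 : 0 <= s by rewrite sumr_ge0// => i _; rewrite sqr_ge0.
rewrite mulrDl mul1r mulr_suml; apply: ler_wpDl => //.
apply: ler_sum => j _; rewrite mxE.
have us i : `|u 0 i| <= Num.sqrt s.
  rewrite -sqrtr_sqr ler_sqrt// /s (bigD1 i)//= lerDl sumr_ge0// => k _.
  by rewrite sqr_ge0.
rewrite -[s](sqr_sqrtr s0) -exprMn -real_normK ?num_real//.
rewrite ler_pXn2r// ?nnegrE ?mulr_ge0 ?sqrtr_ge0 ?sumr_ge0//.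
apply: le_trans (ler_norm_sum _ _ _) _; rewrite mulr_suml; apply: ler_sum => i _.
by rewrite normrM mulrC ler_wpM2l.
Qed.

(** The map is linear over the reals only, so it becomes a symmetric matrix on real and imaginary
    parts. Its factorisation yields both the splitting into kernel and range and a lower bound for
    [D] on its range. *)
Lemma selfadjoint_decomposition m (D : 'cV[C]_m -> 'cV[C]_m) :
  (forall u v, D (u + v) = D u + D v) -> (forall (r : R) u, D (r%:C *: u) = r%:C *: D u) ->
  (forall u v, rdot (D u) v = rdot u (D v)) ->
  exists K : R, [/\ 1 <= K, forall w, exists h, D (w - D h) = 0 &
    forall h, rdot (D h) (D h) <= K * rdot (D (D h)) (D (D h))].
Proof.
move=> DD DZ Dsa.
have rD u v : realify (u + v) = realify u + realify v :> 'rV[R]_(m + m).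
  rewrite /realify add_row_mx; congr row_mx; apply/rowP => i; rewrite !mxE.
    by rewrite ReD.
  by case: (u i 0) (v i 0) => ? ? [].
have rZ (r : R) u : realify (r%:C *: u) = r *: realify u :> 'rV[R]_(m + m).
  rewrite /realify scale_row_mx; congr row_mx; apply/rowP => i; rewrite !mxE.
    by rewrite Re_realM.
  by case: (u i 0) => a b /=; rewrite mul0r addr0.
have rB u v : realify (u - v) = realify u - realify v :> 'rV[R]_(m + m).
  by apply/eqP; rewrite eq_sym subr_eq -rD subrK.
have r0 : realify (0 : 'cV[C]_m) = 0 by rewrite -(subrr 0) rB subrr.
have inj := can_inj (@realifyK m).
have cD u v : complexify (u + v) = complexify u + complexify v :> 'cV[C]_m.
  by apply: inj; rewrite rD !complexifyK.
have cZ (r : R) u : complexify (r *: u) = r%:C *: complexify u :> 'cV[C]_m.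
  by apply: inj; rewrite rZ !complexifyK.
pose f (v : 'rV[R]_(m + m)) := realify (D (complexify v)).
have flin : linear f by move=> r u v; rewrite /f cD cZ DD DZ rD rZ.
pose L : {linear 'rV[R]_(m + m) -> 'rV[R]_(m + m)} :=
  HB.pack f (GRing.isLinear.Build _ _ _ _ f flin).
pose A := lin1_mx L.
have AE v : realify v *m A = realify (D v).
  by rewrite mul_rV_lin1 /= /f realifyK.
have AT : A^T = A.
  apply/matrixP => i j; rewrite mxE.
  have ent k l : A k l = (realify (D (complexify (delta_mx 0 k))) *m
      (realify (complexify (delta_mx 0 l)))^T) 0 0.
    rewrite -AE !complexifyK -rowE !mxE (bigD1 l)//= big1 ?addr0.
      by rewrite !mxE !eqxx mulr1.
    by move=> i' /negPf il; rewrite !mxE il andbF mulr0.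
  by rewrite !ent -!rdot_realify rdotC Dsa.
have [E AEE] := sym_mul_factor AT.
have [K K1 KE] := mulmx_bound E^T.
exists K; split => // [w|h].
  exists (complexify (realify w *m E)); apply: inj.
  rewrite -AE.
  rewrite r0 rB -AE complexifyK.
  by rewrite mulmxBl {1}AEE !mulmxA subrr.
rewrite !rdot_realify -!AE.
(* Transposing the factorisation recovers [D h] from [D (D h)] through the bounded matrix [E^T]. *)
have AE2 : realify h *m A = realify h *m A *m A *m E^T.
  have : A = A *m A *m E^T by rewrite -{1}AT {1}AEE !trmx_mul AT mulmxA.
  by move=> {1}->; rewrite !mulmxA.
by have := KE (realify h *m A *m A); rewrite -AE2.
Qed.

End RealInner.

Section TwoProjections.
Variables (R : realType) (m : nat).
Local Notation C := R[i].
Local Notation V := ('cV[C]_m).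
Implicit Types (P Q : V -> V) (u v w h : V).

(** Homogeneity is asked for real scalars only: projecting onto the tangent directions of a torus is
    not complex-linear. *)
Definition real_projection P : Prop :=
  [/\ forall u v, P (u + v) = P u + P v,
      forall (r : R) u, P (r%:C *: u) = r%:C *: P u,
      forall u, P (P u) = P u &
      forall u v, rdot (P u) v = rdot u (P v)].

Lemma real_projectionB P u v : real_projection P -> P (u - v) = P u - P v.
Proof.
move=> [PD _ _ _]; apply/eqP; rewrite eq_sym subr_eq -PD subrK; exact: eqxx.
Qed.

Lemma real_projection_pythagoras P u v : real_projection P ->
  rdot (P u + (v - P v)) (P u + (v - P v)) =
  rdot (P u) u + rdot v v - rdot (P v) v.
Proof.
move=> [_ _ PP Psa].
rewrite !(rdotDl, rdotDr, rdotNl, rdotNr).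
have e x y : rdot (P x) (P y) = rdot (P x) y by rewrite -Psa PP.
rewrite !e [rdot v (P u)]rdotC [rdot v (P v)]rdotC.
have -> : rdot (P v) u = rdot (P u) v by rewrite Psa rdotC.
by ring.
Qed.

Lemma real_projection_le P u : real_projection P -> vnorm (P u) <= vnorm u.
Proof.
move=> Pp; rewrite vnorm_le_sqr; have [_ _ PP Psa] := Pp.
have := real_projection_pythagoras 0 u Pp.
have P0 : P 0 = 0 by rewrite -[X in P X](subrr 0) real_projectionB// subrr.
rewrite P0 rdot0l !add0r => h; have := rdot_ge0 (u - P u); rewrite h.
by rewrite -[in X in _ -> X <= _]Psa PP subr_ge0.
Qed.

Definition dr_step P Q v := P (Q v) + ((v - Q v) - P (v - Q v)).

Lemma two_projections P Q : real_projection P -> real_projection Q ->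
  exists ga : R, [/\ 0 <= ga, ga < 1,
    forall w, exists h, P (w - (P h - Q h)) = Q (w - (P h - Q h)),
    forall h, exists h', dr_step P Q (P h - Q h) = P h' - Q h' &
    forall h, vnorm (dr_step P Q (P h - Q h)) <= ga * vnorm (P h - Q h)].
Proof.
move=> Pp Qp.
have PB u v : P (u - v) = P u - P v by exact: real_projectionB.
have QB u v : Q (u - v) = Q u - Q v by exact: real_projectionB.
have P0 : P 0 = 0 by rewrite -[X in P X](subrr 0) PB subrr.
have PN v : P (- v) = - P v by rewrite -sub0r PB P0 sub0r.
have [PD PZ PP Psa] := Pp; have [QD QZ QQ Qsa] := Qp.
pose D v := P v - Q v.
have DB u v : D (u - v) = D u - D v.
  by rewrite /D PB QB; apply/colP => i; rewrite !mxE; ring.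
have [|||K [K1 dec bound]] := @selfadjoint_decomposition R m D.
- by move=> u v; rewrite /D PD QD; apply/colP => i; rewrite !mxE; ring.
- by move=> r u; rewrite /D PZ QZ scalerBr.
- by move=> u v; rewrite /D rdotBl rdotBr Psa Qsa.
have K0 : 0 < K by apply: lt_le_trans K1.
have Ki : 0 < K^-1 <= 1 by rewrite invr_gt0 K0 invf_le1.
(* On the range of [D = P - Q] one has [|v|^2 <= K |D v|^2], so the identity
   [|J v|^2 = |v|^2 - |D v|^2] gives this rate. *)
exists (Num.sqrt (1 - K^-1)); split.
- exact: sqrtr_ge0.
- by rewrite -[X in _ < X]sqrtr1 ltr_sqrt//; lra.
- by move=> w; have [h /subr0_eq hh] := dec w; exists h.
- (* J D = D J^T *)
  move=> h; exists (Q (P h) + ((h - P h) - Q (h - P h))).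
  rewrite /dr_step !(PB, QB, PD, QD, PP, QQ).
  by apply/colP => i; rewrite !mxE; ring.
- move=> h; rewrite !vnorm_rdot -sqrtrM; last by lra.
  rewrite ler_sqrt ?mulr_ge0 ?rdot_ge0//; last by lra.
  (* |J v|^2 + |D v|^2 = |v|^2 *)
  have key v : rdot (dr_step P Q v) (dr_step P Q v) + rdot (D v) (D v) = rdot v v.
    rewrite /dr_step real_projection_pythagoras//.
    (* Written as [P (1 - Q) - (1 - P) Q], the difference has two orthogonal parts, as does [J]. *)
    have -> : D v = P (v - Q v) + (- Q v - P (- Q v)).
      by rewrite /D PB PN; apply/colP => i; rewrite !mxE; ring.
    rewrite real_projection_pythagoras// PN.
    rewrite !rdotNl !rdotNr !opprK.
    have : rdot (Q v) (v - Q v) = 0 by rewrite Qsa QB QQ subrr rdotC rdot0l.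
    rewrite rdotBr => e; rewrite rdotBl !rdotBr [rdot v (Q v)]rdotC.
    lra.
  have := key (D h); rewrite -/(D h) => e.
  have := bound h; rewrite -(ler_pM2l (proj1 (andP Ki))) mulrA mulVf ?gt_eqF// mul1r.
  by rewrite mulrBl mul1r; lra.
Qed.

End TwoProjections.

(** * Linearisation error of the phase map in one coordinate *)

Section PhaseEstimate.
Variable R : realType.
Local Notation C := R[i].

(** The base point is rotated to [b > 0]; [r] and [s] are the radial and tangential displacements.
    The radial error comes from [rho - (b + r)], which is quadratic in [s], and the tangential error
    has the factor [s], so [|s|] appears once in full. *)
Lemma phase_estimate_real (b r s n : R) : 0 < b -> 0 <= n -> n ^+ 2 = r ^+ 2 + s ^+ 2 ->
  n <= b / 2 -> let rho := Num.sqrt ((b + r) ^+ 2 + s ^+ 2) in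
  0 < rho /\ `|b * (b + r) / rho - b| + `|b * s / rho - s| <= 4 / b * `|s| * n.
Proof.
move=> b0 n0 nE nb rho.
have rn : `|r| <= n.
  rewrite -(ler_pXn2r (n := 2))// ?nnegrE// real_normK ?num_real// nE.
  by rewrite lerDl sqr_ge0.
have sn : `|s| <= n.
  rewrite -(ler_pXn2r (n := 2))// ?nnegrE// real_normK ?num_real// nE.
  by rewrite lerDr sqr_ge0.
have /andP[r1 r2] : - n <= r <= n by rewrite -ler_norml.
have rhoE : rho ^+ 2 = (b + r) ^+ 2 + s ^+ 2.
  by rewrite sqr_sqrtr// addr_ge0 ?sqr_ge0.
have rho_ge0 : 0 <= rho by exact: sqrtr_ge0.
have rho1 : b + r <= rho.
  rewrite -(ler_pXn2r (n := 2))// ?nnegrE//; last by lra.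
  by rewrite rhoE lerDl sqr_ge0.
have rho2 : b / 2 <= rho by lra.
have rho3 : rho <= b + n.
  rewrite -(ler_pXn2r (n := 2))// ?nnegrE//; last by lra.
  by rewrite rhoE; nra.
have rho4 : b - n <= rho.
  rewrite -(ler_pXn2r (n := 2))// ?nnegrE//; last by lra.
  by rewrite rhoE; nra.
have rho0 : 0 < rho by lra.
split => //.
have e1 : `|b * (b + r) / rho - b| = b * (rho - (b + r)) / rho.
  have -> : b * (b + r) / rho - b = - (b * (rho - (b + r)) / rho).
    by field; rewrite gt_eqF.
  rewrite normrN ger0_norm// divr_ge0// mulr_ge0//; lra.
have e2 : `|b * s / rho - s| = `|s| * `|b - rho| / rho.
  have -> : b * s / rho - s = s * (b - rho) / rho by field; rewrite gt_eqF.
  by rewrite !normrM normfV [`|rho|]ger0_norm.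
(* From [rho >= b / 2], the factor [2 / b * rho] is at least [1] and absorbs the division by
   [rho]. *)
have h2 : `|s| * n <= `|s| * n * (2 / b * rho).
  rewrite -[X in X <= _]mulr1; apply: ler_wpM2l; first by rewrite mulr_ge0.
  rewrite mulrAC ler_pdivlMr// mul1r; lra.
have b1 : b * (rho - (b + r)) / rho <= 2 / b * `|s| * n.
  have : rho - (b + r) <= `|s| ^+ 2 / b.
    rewrite ler_pdivlMr//.
    have : (rho - (b + r)) * (rho + (b + r)) = `|s| ^+ 2.
      by rewrite real_normK ?num_real//; rewrite -subr_sqr rhoE; ring.
    move=> <-; apply: ler_wpM2l; lra.
  move=> h; rewrite ler_pdivrMr//.
  apply: (@le_trans _ _ (`|s| ^+ 2)).
    by have := ler_wpM2l (ltW b0) h; rewrite mulrCA divff ?mulr1// gt_eqF.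
  apply: (le_trans _ (le_trans h2 _)); first by rewrite expr2 ler_wpM2l.
  by rewrite le_eqVlt; apply/orP; left; apply/eqP; ring.
have b2 : `|s| * `|b - rho| / rho <= 2 / b * `|s| * n.
  rewrite ler_pdivrMr//.
  have h : `|b - rho| <= n by rewrite ler_norml; apply/andP; split; lra.
  apply: (@le_trans _ _ (`|s| * n)); first by rewrite ler_wpM2l.
  apply: (le_trans h2).
  by rewrite le_eqVlt; apply/orP; left; apply/eqP; ring.
rewrite e1 e2; apply: (le_trans (lerD b1 b2)).
by rewrite le_eqVlt; apply/orP; left; apply/eqP; field; rewrite gt_eqF.
Qed.

End PhaseEstimate.

(** * Local convergence *)

Section PhaseC.
Variable R : realType.
Local Notation C := R[i].

Lemma normc_ge0 (z : C) : 0 <= normc z.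
Proof. by case: z => a b; exact: sqrtr_ge0. Qed.

Lemma normr_normc (z : C) : `|z| = (normc z)%:C.
Proof. by []. Qed.

Lemma normc_eq0 (z : C) : (normc z == 0) = (z == 0).
Proof. by apply/eqP/eqP => [/eq0_normc//|->]; rewrite normc0. Qed.

Lemma sqr_normc_real (z : C) : normc z ^+ 2 = complex.Re z ^+ 2 + complex.Im z ^+ 2.
Proof. by case: z => a b /=; rewrite sqr_sqrtr// addr_ge0 ?sqr_ge0. Qed.

Lemma Im_le_normc (z : C) : `|complex.Im z| <= normc z.
Proof.
rewrite -(ler_pXn2r (n := 2))// ?nnegrE ?normc_ge0// real_normK ?num_real//.
by rewrite sqr_normc_real lerDr sqr_ge0.
Qed.

Lemma Re_le_normc (z : C) : `|complex.Re z| <= normc z.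
Proof.
rewrite -(ler_pXn2r (n := 2))// ?nnegrE ?normc_ge0// real_normK ?num_real//.
by rewrite sqr_normc_real lerDl sqr_ge0.
Qed.

Lemma normc_le_ReIm (z : C) : normc z <= `|complex.Re z| + `|complex.Im z|.
Proof.
rewrite -(ler_pXn2r (n := 2))// ?nnegrE ?normc_ge0 ?addr_ge0//.
rewrite sqr_normc_real sqrrD !real_normK ?num_real//.
by rewrite -addrA [_ *+ 2 + _]addrC addrA lerDl mulrn_wge0// mulr_ge0.
Qed.

Lemma normc_conj (z : C) : normc (Num.conj z) = normc z.
Proof. by case: z => a b /=; rewrite sqrrN. Qed.

(* The unit tangent at [z] to the circle through [z]; it is [0] at [z = 0],
   where [y |-> b * phase y] is constant because [b = 0]. *)
Definition tangent (z : C) : C := 'i * (z / `|z|).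

(** Dividing by the phase of [z] reduces to the real estimate. As [f] is radial, the tangential
    displacement comes from [g] alone, which makes the error bilinear in [g] and the total
    offset. *)
Lemma phase_estimate (z f g : C) : z != 0 ->
  complex.Re (f * Num.conj (tangent z)) = 0 ->
  normc f + normc g <= normc z / 2 ->
  let a := z + f + g in
  a != 0 /\ normc ((normc z)%:C * (a / `|a|) - z -
      (complex.Re (g * Num.conj (tangent z)))%:C * tangent z)
    <= 4 / normc z * normc g * (normc f + normc g).
Proof.
move=> z0; set b := normc z => f_tan fg a.
have b0 : 0 < b by rewrite lt_neqAle normc_ge0 andbT eq_sym normc_eq0.
pose om : C := z / b%:C.
have bC : b%:C != 0 :> C by rewrite -normr_normc normr_eq0.
have om1 : normc om = 1.
  rewrite normcM normcV /= expr0n addr0 sqrtr_sqr gtr0_norm// divff// gt_eqF//.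
have omom : om * Num.conj om = 1 by rewrite -sqr_normc normr_normc om1 expr1n.
have zE : z = om * b%:C by rewrite divfK.
have tanE : tangent z = 'i * om by [].
pose f1 := f * Num.conj om; pose g1 := g * Num.conj om.
have fE : f = om * f1 by rewrite /f1 mulrCA omom mulr1.
have gE : g = om * g1 by rewrite /g1 mulrCA omom mulr1.
have nf1 : normc f1 = normc f by rewrite normcM normc_conj om1 mulr1.
have ng1 : normc g1 = normc g by rewrite normcM normc_conj om1 mulr1.
have Re_tan (h : C) : complex.Re (h * Num.conj (tangent z)) =
    complex.Im (h * Num.conj om).
  rewrite tanE rmorphM /= mulrCA; case: (h * _) => x y /=; ring.
move: f_tan; rewrite Re_tan -/f1 => f_tan.
rewrite Re_tan -/g1 tanE; set s := complex.Im g1.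
pose r := complex.Re f1 + complex.Re g1.
pose n := normc (f1 + g1).
have nle : n <= normc f + normc g by rewrite -nf1 -ng1; exact: le_normcD.
have nE : n ^+ 2 = r ^+ 2 + s ^+ 2.
  rewrite sqr_normc_real; congr (_ ^+ 2 + _ ^+ 2).
    by rewrite ReD.
  by rewrite /s; move: f_tan; case: (f1) (g1) => ? ? [? ?] /= ->; rewrite add0r.
have [rho0 est] := phase_estimate_real b0 (normc_ge0 _ : 0 <= n) nE (le_trans nle fg).
set rho := Num.sqrt _ in rho0 est.
pose a1 : C := (b + r) +i* s.
have aE : a = om * a1.
  rewrite /a {1}zE {1}fE {1}gE -!mulrDr; congr (_ * _).
  rewrite /a1 /r /s; move: f_tan; case: (f1) (g1) => ? ? [? ?] /= ->. simpc.
  by rewrite addrA.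
have na : normc a = rho by rewrite aE normcM om1 mul1r.
split; first by rewrite -normc_eq0 na gt_eqF.
rewrite normr_normc na.
have -> : b%:C * (a / rho%:C) - z - s%:C * ('i * om) =
    om * ((b * (b + r) / rho - b) +i* (b * s / rho - s)).
  rewrite {1}zE aE.
  have -> : (b * (b + r) / rho - b) +i* (b * s / rho - s) =
      b%:C * a1 / rho%:C - b%:C - s%:C * 'i.
    have -> : (rho%:C)^-1 = (rho^-1)%:C :> C by rewrite fmorphV.
    by rewrite /a1; simpc; congr (_ +i* _); ring.
  by ring.
rewrite normcM om1 mul1r; apply: (le_trans (normc_le_ReIm _)) => /=.
apply: (le_trans est).
have b4 : 0 <= 4 / b by rewrite divr_ge0// ltW.
apply: ler_pM => //; first by rewrite mulr_ge0.
  exact: normc_ge0.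
by rewrite ler_wpM2l// -ng1; exact: Im_le_normc.
Qed.

End PhaseC.

(** * Removal of the global phase *)

Section Alignment.
Variables (R : realType) (m : nat).
Local Notation C := R[i].
Local Notation V := ('cV[C]_m).
Implicit Types (u v w a : V).

Lemma rdot_scale (c : C) u v : rdot (c *: u) v =
  complex.Re c * rdot u v - complex.Im c * rdot u ('i *: v).
Proof.
rewrite !rdotE !mulr_sumr -sumrB; apply: eq_bigr => i _; rewrite !mxE.
by case: (u i 0) (v i 0) c => [p q] [r s] [x y] /=; ring.
Qed.

Lemma rdot_ii u v : rdot u ('i *: ('i *: v)) = - rdot u v.
Proof. by rewrite scalerA -expr2 sqr_i scaleN1r rdotNr. Qed.

Lemma rdot_i_self u : rdot u ('i *: u) = 0.
Proof.
have := rdot_scale 'i u u; rewrite rdotC /= mul0r mul1r sub0r; lra.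
Qed.

Lemma normc1_conj (e : C) : normc e = 1 -> e * Num.conj e = 1.
Proof. by move=> e1; rewrite -sqr_normc [`|e|]/((normc e)%:C) e1 expr1n. Qed.

(** [X +i* Y] is the Hermitian product of [a] and [y], and [e] is its phase. Rotating back makes the
    product real and positive: the component along [i y] disappears and the distance to [y] does not
    grow. *)
Lemma phase_alignment a y : 0 < rdot a y -> exists e : C, [/\ normc e = 1,
  rdot (Num.conj e *: a) ('i *: y) = 0,
  vnorm (Num.conj e *: a - y) <= vnorm (a - y) &
  normc (Num.conj e - 1) <= 2 * `|rdot a ('i *: y)| / rdot a y].
Proof.
set X := rdot a y; set Y := rdot a ('i *: y) => X0.
pose z : C := X +i* Y; set rho := normc z.
have rhoE : rho ^+ 2 = X ^+ 2 + Y ^+ 2 by rewrite sqr_normc_real.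
have Xrho : X <= rho by apply: le_trans (ler_norm _) (Re_le_normc z).
have rho0 : 0 < rho by apply: lt_le_trans Xrho.
have rhoN : rho != 0 by rewrite gt_eqF.
have rhoXY : rho <= X + `|Y|.
  by apply: le_trans (normc_le_ReIm z) _; rewrite /= [`|X|]gtr0_norm.
pose e : C := (X / rho) +i* (Y / rho).
have eE : e = z * (rho^-1)%:C by rewrite /e /z; simpc.
have e1 : normc e = 1.
  by rewrite eE normcM /= expr0n addr0 sqrtr_sqr gtr0_norm ?invr_gt0// divff.
have ay : rdot (Num.conj e *: a) y = rho.
  rewrite rdot_scale /= -/X -/Y.
  by apply: (mulIf rhoN); rewrite -[RHS]expr2 rhoE; field.
exists e; split => //.
- rewrite rdot_scale rdot_ii /= -/X -/Y.
  by field.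
- rewrite vnorm_le_sqr !(rdotDl, rdotDr, rdotNl, rdotNr) !opprK.
  rewrite -vnorm_sqr vnorm_scale normc_conj e1 mul1r vnorm_sqr.
  rewrite [rdot y (_ *: _)]rdotC ay [rdot y a]rdotC -/X; lra.
- apply: (le_trans (normc_le_ReIm _)); rewrite /e /= subr0.
  have -> : X / rho - 1 = - ((rho - X) / rho) by field.
  rewrite !normrN !normrM normfV [`|rho|]gtr0_norm// ger0_norm ?subr_ge0//.
  rewrite -mulrDl ler_pdivrMr// mulrAC ler_pdivlMr//.
  have : 0 <= `|Y| by [].
  move: `|Y| rhoXY => y' rhoXY y0; nra.
Qed.
End Alignment.

(** * Splitting offsets between the kernel and the range of the difference of the projections *)

Section Dynamics.
Variables (R : realType) (m : nat).
Local Notation C := R[i].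
Local Notation V := ('cV[C]_m).
Variables (y0 : V) (P Q : V -> V).
Local Notation iy := ('i *: y0).
Hypotheses (Pp : real_projection P) (Qp : real_projection Q).
Hypothesis PZ : forall (c : C) u, P (c *: u) = c *: P u.
Hypotheses (y0n0 : y0 != 0) (Py : P y0 = y0) (Qiy : Q iy = iy).
Hypothesis PQ : forall v, P v = v -> Q v = v -> exists r : R, v = r%:C *: iy.

Local Notation D h := (P h - Q h).

Let PB u v : P (u - v) = P u - P v. Proof. exact: real_projectionB. Qed.

Lemma fixed_orthogonal f h : P f = Q f -> rdot f (D h) = 0.
Proof.
move=> fE; have [_ _ _ Psa] := Pp; have [_ _ _ Qsa] := Qp.
by rewrite rdotBr -Psa -Qsa fE subrr.
Qed.

Lemma rdot_y0_gt0 : 0 < rdot y0 y0.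
Proof.
rewrite lt_neqAle rdot_ge0 andbT eq_sym; apply: contraNneq y0n0 => /rdot_eq0 ->.
exact: eqxx.
Qed.

(** [P f = Q f] lies in both ranges, hence on the line of [i y0], and its component along that line
    is the one of [f], which vanishes. *)
Lemma fixed_without_phase f : P f = Q f -> rdot f iy = 0 -> P f = 0 /\ Q f = 0.
Proof.
move=> fE f0; have [_ _ PP Psa] := Pp; have [_ _ QQ Qsa] := Qp.
have [||r rE] := PQ (v := P f); rewrite ?PP//.
  by rewrite fE QQ.
suff r0 : r = 0 by rewrite -fE rE r0 scale0r.
have Piy : P iy = iy by rewrite PZ Py.
have : rdot (P f) iy = 0 by rewrite Psa Piy.
rewrite rE rdotZl rdot_scale rdot_ii /= mul0r mul1r sub0r opprK => /eqP.
by rewrite mulf_eq0 (gt_eqF rdot_y0_gt0) orbF => /eqP.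
Qed.

Lemma split_offset w : (forall w', exists h, P (w' - D h) = Q (w' - D h)) ->
  exists h, [/\ P (w - D h) = Q (w - D h), vnorm (D h) <= vnorm w &
    vnorm (w - D h) <= vnorm w].
Proof.
move=> dec; have [h hE] := dec w; exists h.
pose f := w - D h; have wE : w = f + D h by rewrite subrK.
have o : rdot f (D h) = 0 by exact: fixed_orthogonal.
have e : rdot w w = rdot f f + rdot (D h) (D h).
  rewrite wE; clear wE; move: f (D h) o => f g o.
  by rewrite rdotDl !rdotDr [rdot g f]rdotC o; ring.
by split => //; rewrite vnorm_le_sqr e ?lerDl ?lerDr rdot_ge0.
Qed.

(* 7 = 1 + 4 * 3/2: rotating back costs [4 |E| / |y0|] times [|a| <= 3/2 |y0|]. *)
Lemma realign_perturbation f g E :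
  (forall w', exists h, P (w' - D h) = Q (w' - D h)) ->
  P f = 0 -> Q f = 0 -> (exists h, g = D h) ->
  vnorm f + vnorm g + vnorm E <= vnorm y0 / 2 ->
  exists (e : C) (f' g' : V), [/\ normc e = 1, P f' = 0 /\ Q f' = 0,
    exists h, g' = D h, y0 + f + g + E = e *: (y0 + f' + g') &
    vnorm f' <= vnorm f + 7 * vnorm E /\ vnorm g' <= vnorm g + 7 * vnorm E].
Proof.
move=> dec Pf Qf [h gE] small.
have [_ _ PP Psa] := Pp; have [_ _ QQ Qsa] := Qp.
have Piy : P iy = iy by rewrite PZ Py.
have y00 : 0 < vnorm y0 by rewrite vnorm_rdot sqrtr_gt0 rdot_y0_gt0.
set a := y0 + f + g + E.
have fiy : rdot f iy = 0 by rewrite -Piy -Psa Pf rdot0l.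
have giy : rdot g iy = 0.
  by rewrite gE rdotC; apply: fixed_orthogonal; rewrite Piy Qiy.
have n_iy : vnorm iy = vnorm y0.
  by rewrite vnorm_scale /= expr0n add0r expr1n sqrtr1 mul1r.
have Y : rdot a iy = rdot E iy.
  by rewrite !rdotDl rdot_i_self fiy giy !add0r.
have absY : `|rdot a iy| <= vnorm E * vnorm y0.
  rewrite Y ler_norml; apply/andP; split; last by rewrite -n_iy rdot_cauchy.
  by rewrite lerNl -rdotNl -n_iy -(vnormN E) rdot_cauchy.
have aE : a = y0 + (f + g + E) by rewrite /a !addrA.
have nfgE : vnorm (f + g + E) <= vnorm y0 / 2.
  apply: le_trans small; apply: le_trans (vnormD _ _) _; rewrite lerD2r.
  exact: vnormD.
have X : vnorm y0 ^+ 2 / 2 <= rdot a y0.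
  have := rdot_cauchy (- (f + g + E)) y0; rewrite vnormN rdotNl => cs.
  rewrite aE rdotDl -vnorm_sqr.
  have := ler_wpM2r (ltW y00) nfgE; lra.
have X0 : 0 < rdot a y0.
  by apply: lt_le_trans X; rewrite divr_gt0// exprn_gt0.
have [e [e1 e_iy _ e_near]] := phase_alignment X0.
have ee := normc1_conj e1.
pose w := Num.conj e *: a - y0.
have w_iy : rdot w iy = 0 by rewrite rdotBl e_iy rdot_i_self subrr.
(* [E2] is the perturbation after rotating back; it collects [E] and the rotation defect
   [(conj e - 1) a]. *)
pose E2 := w - f - g.
have E2E : E2 = (Num.conj e - 1) *: a + E.
  rewrite /E2 /w /a; apply/colP => i; rewrite !mxE; ring.
have nE2 : vnorm E2 <= 7 * vnorm E.
  rewrite E2E; apply: le_trans (vnormD _ _) _; rewrite vnorm_scale.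
  have na : vnorm a <= 3 / 2 * vnorm y0.
    rewrite aE; apply: le_trans (vnormD _ _) _; lra.
  have ne : normc (Num.conj e - 1) <= 4 * vnorm E / vnorm y0.
    apply: le_trans e_near _; rewrite ler_pdivrMr//.
    have h1 : 4 * vnorm E / vnorm y0 * (vnorm y0 ^+ 2 / 2) = 2 * (vnorm E * vnorm y0).
      by field; rewrite gt_eqF.
    have h2 : 0 <= 4 * vnorm E / vnorm y0.
      by rewrite divr_ge0 ?vnorm_ge0// mulr_ge0 ?vnorm_ge0.
    have := ler_wpM2l h2 X; rewrite h1; lra.
  have := ler_pM (normc_ge0 _) (vnorm_ge0 _) ne na.
  have -> : 4 * vnorm E / vnorm y0 * (3 / 2 * vnorm y0) = 6 * vnorm E.
    by field; rewrite gt_eqF.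
  lra.
(* The kernel part of [E2] joins [f] and the range part joins [g]. Since [w] and [g] are orthogonal
   to [i y0], so is the new [f], and both projections kill it. *)
have [h' [fix' n1 n2]] := split_offset E2 dec.
have [PD _ _ _] := Pp; have [QD _ _ _] := Qp.
exists e, (f + (E2 - D h')), (g + D h'); split => //.
- apply: fixed_without_phase; first by rewrite PD QD Pf Qf fix'.
  have -> : f + (E2 - D h') = w - g - D h'.
    by rewrite /E2; apply/colP => i; rewrite !mxE; ring.
  rewrite (rdotBl (w - g)) (rdotBl w) w_iy giy [X in _ - X]rdotC fixed_orthogonal ?Piy ?Qiy//.
  by rewrite !subr0.
- exists (h + h'); rewrite gE PD QD.
  by apply/colP => i; rewrite !mxE; ring.
- have -> : y0 + (f + (E2 - D h')) + (g + D h') = Num.conj e *: a.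
    by rewrite /E2 /w; apply/colP => i; rewrite !mxE; ring.
  by rewrite scalerA ee scale1r.
- split; apply: le_trans (vnormD _ _) _; lra.
Qed.

(** A start in the range of [P] needs no component [f]: after alignment such a component would be
    killed by [P], hence orthogonal to [w] and to [D h], and therefore to itself. *)
Lemma align_start a : (forall w', exists h, P (w' - D h) = Q (w' - D h)) ->
  P a = a -> vnorm (a - y0) < vnorm y0 ->
  exists (e : C) (g : V), [/\ normc e = 1, exists h, g = D h,
    a = e *: (y0 + g) & vnorm g <= vnorm (a - y0)].
Proof.
move=> dec Pa small.
have [_ _ PP Psa] := Pp.
have y00 : 0 < vnorm y0 by rewrite vnorm_rdot sqrtr_gt0 rdot_y0_gt0.
have X0 : 0 < rdot a y0.
  have := rdot_cauchy (- (a - y0)) y0; rewrite vnormN rdotNl rdotBl -vnorm_sqr.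
  have : vnorm (a - y0) * vnorm y0 < vnorm y0 ^+ 2 by rewrite expr2 ltr_pM2r.
  lra.
have [e [e1 e_iy le _]] := phase_alignment X0.
pose w := Num.conj e *: a - y0.
have w_iy : rdot w iy = 0 by rewrite rdotBl e_iy rdot_i_self subrr.
have Pw : P w = w by rewrite /w PB PZ Pa Py.
have [h [fE _ _]] := split_offset w dec.
have Piy : P iy = iy by rewrite PZ Py.
have [Pf _] : P (w - D h) = 0 /\ Q (w - D h) = 0.
  apply: fixed_without_phase => //; rewrite rdotBl w_iy [X in _ - X]rdotC.
  by rewrite fixed_orthogonal ?Piy ?Qiy// subrr.
have wE : w = D h.
  apply/eqP; rewrite -subr_eq0; apply/eqP/rdot_eq0.
  have o : rdot (w - D h) (P w) = 0 by rewrite -Psa Pf rdot0l.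
  rewrite Pw in o.
  by rewrite (rdotBr w) o fixed_orthogonal// subrr.
exists e, w; split => //; first by exists h.
have -> : y0 + w = Num.conj e *: a by rewrite /w addrC subrK.
by rewrite scalerA normc1_conj// scale1r.
Qed.

End Dynamics.

(** * The tangent projection of the torus and the remainder of the phase map *)

Section TangentProjection.
Variables (R : realType) (N : nat).
Local Notation C := R[i].
Local Notation V := ('cV[C]_N).
Variable y : V.

Definition tangent_proj (v : V) : V := \col_i
  ((complex.Re (v i 0 * Num.conj (tangent (y i 0))))%:C * tangent (y i 0)).

Local Notation Q := tangent_proj.

Lemma conj_real_complex (r : R) : Num.conj (r%:C : C) = r%:C.
Proof. exact: conjc_real. Qed.

Lemma tangent_norm (z : C) : z != 0 -> tangent z * Num.conj (tangent z) = 1.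
Proof.
move=> z0; apply: normc1_conj; rewrite /tangent !normcM normcV.
rewrite [`|z|]/((normc z)%:C) /= !(expr0n, add0r, addr0, expr1n) sqrtr1 mul1r.
rewrite sqrtr_sqr ger0_norm ?normc_ge0// divff// normc_eq0//.
Qed.

Lemma tangent0 : tangent (0 : C) = 0.
Proof. by rewrite /tangent mul0r mulr0. Qed.

Lemma tangent_projP : real_projection Q.
Proof.
split => [u v|r u|u|u v].
- by apply/colP => i; rewrite !mxE mulrDl ReD rmorphD mulrDl.
- by apply/colP => i; rewrite !mxE -mulrA Re_realM rmorphM mulrA.
- apply/colP => i; rewrite !mxE; have [->|z0] := eqVneq (y i 0) 0.
    by rewrite tangent0 !mulr0.
  by rewrite -mulrA tangent_norm// mulr1.
- rewrite !rdotE; apply: eq_bigr => i _; rewrite !mxE.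
  rewrite -mulrA Re_realM [Num.conj (_%:C * _)]rmorphM /= conj_real_complex.
  rewrite mulrCA Re_realM mulrC; congr (_ * _).
  by rewrite !Re_mul_conj; ring.
Qed.

Lemma tangent_proj_iy : Q ('i *: y) = 'i *: y.
Proof.
apply/colP => i; rewrite !mxE; set z := y i 0.
have [->|z0] := eqVneq z 0; first by rewrite tangent0 !mulr0.
rewrite /tangent; set w := z / `|z|.
have nz : (normc z)%:C != 0 :> C by rewrite -normr_normc normr_eq0.
have zE : z = (normc z)%:C * w by rewrite /w [`|z|]normr_normc mulrCA divff// mulr1.
have -> : 'i * z = (normc z)%:C * ('i * w) by rewrite {1}zE mulrCA.
rewrite -[X in complex.Re X]mulrA Re_realM.
by rewrite -/(tangent z) tangent_norm//= mulr1.
Qed.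

(** The first-order error of the magnitude projection at [y]. The linear term holds only [Q g]
    because the remainder is estimated for [Q f = 0]. *)
Definition remainder (f g : V) : V :=
  hadamard (absv y) (phase (y + f + g)) - y - Q g.

Lemma normc_le_vnorm m (u : 'cV[C]_m) i : normc (u i 0) <= vnorm u.
Proof.
rewrite -(ler_pXn2r (n := 2))// ?nnegrE ?normc_ge0 ?vnorm_ge0//.
rewrite vnorm_sqr rdotE (bigD1 i)//= Re_mul_conj sqr_normc_real !expr2 lerDl.
apply: sumr_ge0 => j _; rewrite Re_mul_conj -!expr2.
by rewrite addr_ge0 ?sqr_ge0.
Qed.

Lemma vnorm_le_normc m (u v : 'cV[C]_m) (K : R) : 0 <= K ->
  (forall i, normc (u i 0) <= K * normc (v i 0)) -> vnorm u <= K * vnorm v.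
Proof.
move=> K0 h; rewrite -(ler_pXn2r (n := 2))// ?nnegrE ?mulr_ge0 ?vnorm_ge0//.
rewrite exprMn !vnorm_sqr !rdotE mulr_sumr; apply: ler_sum => i _.
rewrite !Re_mul_conj -!expr2 -!sqr_normc_real -exprMn.
by rewrite ler_pXn2r// nnegrE ?mulr_ge0 ?normc_ge0.
Qed.

Lemma min_modulus : exists2 bm : R, 0 < bm & forall i, y i 0 != 0 -> bm <= normc (y i 0).
Proof.
exists (\big[Num.min/1]_(i | y i 0 != 0) normc (y i 0)).
  elim/big_ind: _ => //; first by move=> p q p0 q0; rewrite lt_min p0.
  by move=> i h; rewrite lt_neqAle normc_ge0 andbT eq_sym normc_eq0.
by move=> i h; rewrite bigmin_le_cond.
Qed.

(** With [bm] a lower bound of the nonzero moduli of [y], [4 / bm] dominates the constants of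
    [phase_estimate], and [bm / 2] keeps every displacement within half a modulus. At zeros of [y]
    the remainder vanishes, the prescribed modulus being [0]. *)
Lemma remainder_bound : exists K d : R, [/\ 0 <= K, 0 < d &
  forall f g, Q f = 0 -> vnorm f + vnorm g <= d ->
    (forall i, y i 0 != 0 -> (y + f + g) i 0 != 0) /\
    vnorm (remainder f g) <= K * (vnorm f + vnorm g) * vnorm g].
Proof.
have [bm bm0 bmE] := min_modulus.
exists (4 / bm), (bm / 2); split; [by rewrite divr_ge0// ltW|by rewrite divr_gt0|].
move=> f g Qf small.
have key i : y i 0 != 0 -> (y + f + g) i 0 != 0 /\
    normc ((remainder f g) i 0) <=
    4 / bm * (vnorm f + vnorm g) * normc (g i 0).
  move=> z0.
  have f_tan : complex.Re (f i 0 * Num.conj (tangent (y i 0))) = 0.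
    have := congr1 (fun v : V => v i 0) Qf; rewrite /tangent_proj [LHS]mxE [RHS]mxE.
    move=> /(congr1 (fun z => z * Num.conj (tangent (y i 0)))).
    rewrite -mulrA tangent_norm// mulr1 mul0r => /(congr1 (@complex.Re R)).
    by [].
  have fg : normc (f i 0) + normc (g i 0) <= vnorm f + vnorm g.
    by rewrite lerD ?normc_le_vnorm.
  have [|a0 est] := @phase_estimate _ _ _ (g i 0) z0 f_tan.
    apply: (le_trans fg); apply: (le_trans small).
    by rewrite ler_pM2r ?invr_gt0// bmE.
  have aE : (y + f + g) i 0 = y i 0 + f i 0 + g i 0 by rewrite 2!mxE.
  split; first by rewrite aE.
  have -> : remainder f g i 0 = (normc (y i 0))%:C * ((y i 0 + f i 0 + g i 0) /
      `|y i 0 + f i 0 + g i 0|) - y i 0 -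
      (complex.Re (g i 0 * Num.conj (tangent (y i 0))))%:C * tangent (y i 0).
    by rewrite /remainder !mxE (negPf a0).
  apply: (le_trans est); rewrite -!mulrA.
  have b0 : 0 < normc (y i 0) by apply: lt_le_trans (bmE _ z0).
  have bi : (normc (y i 0))^-1 <= bm^-1 by rewrite lef_pV2 ?posrE ?bmE.
  rewrite ler_wpM2l// ler_pM ?invr_ge0 ?mulr_ge0 ?addr_ge0 ?normc_ge0// mulrC.
  by rewrite ler_wpM2r ?normc_ge0.
split=> [i /key[]//|].
apply: vnorm_le_normc.
  by rewrite mulr_ge0 ?addr_ge0 ?vnorm_ge0// divr_ge0// ltW.
move=> i; have [z0|/key[]//] := eqVneq (y i 0) 0.
have -> : remainder f g i 0 = 0.
  by rewrite /remainder !mxE z0 normr0 mul0r tangent0 mulr0 !subr0.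
by rewrite normc0 mulr_ge0 ?normc_ge0// mulr_ge0 ?addr_ge0 ?vnorm_ge0// divr_ge0// ltW.
Qed.

End TangentProjection.

(** * The FDR iteration near the orbit of the measured vector *)

Section LocalConvergence.
Variables (R : realType) (N n : nat).
Local Notation C := R[i].
Variables (As : 'M[C]_(N, n)) (x0 : 'cV[C]_n).
Hypothesis iso : As^t* *m As = 1%:M.
Hypothesis x0n0 : x0 != 0.
Hypothesis uniq : forall x, (forall i, complex.Im ((As *m x) i 0 *
  Num.conj ((As *m x0) i 0)) = 0) -> exists r : R, x = r%:C *: x0.
Local Notation V := ('cV[C]_N).
Local Notation y0 := (As *m x0).
Local Notation b := (absv (As *m x0)).

Definition range_proj (v : V) : V := As *m (As^t* *m v).

Local Notation P := range_proj.
Local Notation Q := (tangent_proj (As *m x0)).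

Lemma range_projP : real_projection P.
Proof.
split => [u v|r u|u|u v].
- by rewrite /range_proj !mulmxDr.
- by rewrite /range_proj -!scalemxAr.
- by rewrite /range_proj; congr (_ *m _); rewrite mulmxA iso mul1mx.
- by rewrite /range_proj rdot_adj [RHS]rdotC rdot_adj rdotC.
Qed.

Lemma range_proj_scale (c : C) v : P (c *: v) = c *: P v.
Proof. by rewrite /range_proj -!scalemxAr. Qed.

Lemma range_proj_y0 : P y0 = y0.
Proof. by rewrite /range_proj [As^t* *m _]mulmxA iso mul1mx. Qed.

Lemma isometry_norm (u : 'cV[C]_n) : vnorm (As *m u) = vnorm u.
Proof. by rewrite !vnorm_rdot rdot_adj mulmxA iso mul1mx. Qed.

Lemma y0_neq0 : y0 != 0.
Proof.
apply: contraNneq x0n0 => h.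
by rewrite -[x0]mul1mx -iso -mulmxA h mulmx0.
Qed.

(** A tangent vector is [i] times a real multiple of [y0] in each coordinate. Thus [- i A v] has
    real quotient with [x0] after measurement, and [uniq] applies. *)
Lemma fixed_intersection v : P v = v -> Q v = v -> exists r : R, v = r%:C *: ('i *: y0).
Proof.
move=> Pv Qv.
have [|r rE] := @uniq ((- 'i) *: (As^t* *m v)).
  move=> i; rewrite -scalemxAr -/(range_proj v) Pv -Qv [X in complex.Im (X * _)]mxE.
  rewrite [tangent_proj _ _ i 0]mxE.
  set z := (As *m x0) i 0; set s := complex.Re _.
  have [->|z0] := eqVneq z 0; first by rewrite rmorph0 mulr0.
  rewrite /tangent.
  have -> : - 'i * (s%:C * ('i * (z / `|z|))) * Num.conj z =
      s%:C * (z * Num.conj z / `|z|) * (- ('i * 'i)) by ring.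
  rewrite -expr2 sqr_i opprK mulr1 -sqr_normc expr2 mulfK ?normr_eq0//.
  by rewrite normr_normc /= mulr0 mul0r addr0.
exists r; rewrite -Pv /range_proj.
have -> : As^t* *m v = 'i *: (r%:C *: x0).
  by rewrite -rE scalerA mulrN -expr2 sqr_i opprK scale1r.
by rewrite -!scalemxAr scalerA mulrC -scalerA.
Qed.

(** The map commutes with the global phase, fixes [y0], carries [f] along unchanged and acts on [g]
    by the linear step; the remainder enters reflected, as [2 P r - r]. *)
Lemma Sf_expansion (e : C) f g : normc e = 1 -> P f = 0 -> Q f = 0 ->
  (forall i, y0 i 0 != 0 -> (y0 + f + g) i 0 != 0) ->
  Sf As b (e *: (y0 + f + g)) = e *: (y0 + f + dr_step P Q g +
    (2 *: P (remainder y0 f g) - remainder y0 f g)).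
Proof.
move=> e1 Pf Qf nz; set a := y0 + f + g.
(* Setting the phase of [0] to [1] breaks equivariance only at zero coordinates, and by [nz] the
   modulus [b] vanishes there. *)
have equi : hadamard b (phase (e *: a)) = e *: hadamard b (phase a).
  apply/colP => i; have := nz i; rewrite -/a.
  move: (y0) a => z a nzi; rewrite !mxE.
  have [->|z0] := eqVneq (z i 0) 0; first by rewrite normr0 !mul0r mulr0.
  have e0 : e != 0 by rewrite -normc_eq0 e1 oner_eq0.
  rewrite mulf_eq0 (negPf e0) (negPf (nzi z0)) /=.
  by rewrite normrM [`|e|]normr_normc e1 mul1r; ring.
have phE : hadamard b (phase a) = y0 + Q g + remainder y0 f g.
  by rewrite /remainder -/a; move: (As *m x0) => z; apply/colP => i; rewrite !mxE; ring.
have PB u v : P (u - v) = P u - P v by exact: real_projectionB range_projP.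
have [PD _ _ _] := range_projP.
rewrite /Sf equi phE -[As *m (As^t* *m _)]/(P _).
have -> : 2 *: (e *: (y0 + Q g + remainder y0 f g)) - e *: a =
    e *: (2 *: (y0 + Q g + remainder y0 f g) - a).
  by apply/colP => i; rewrite !mxE; ring.
rewrite range_proj_scale -scalerDr -scalerBr; congr (_ *: _).
move: (remainder y0 f g) => r.
rewrite PB range_proj_scale /a !PD range_proj_y0 Pf /dr_step PB.
move: (y0) (Q g) (P g) (P r) (P (Q g)) => z q pg pr pq.
by apply/colP => i; rewrite !mxE; ring.
Qed.

(** The invariant is [y = e (y0 + f + g)] with [f] killed by both projections and [g] in the range
    of their difference. [g] decays geometrically; [f] need not decay, but it gains no more than [g]
    loses, so the iterates stay in the ball of radius [delta]. *)
Lemma local_convergence : exists eps gamma : R, [/\ 0 < eps, 0 <= gamma, gamma < 1 &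
  forall (x : nat -> 'cV[C]_n) (y : nat -> V) (alpha : nat -> C),
    y 1%N = As *m x 1%N ->
    (forall k, (1 <= k)%N -> y k.+1 = Sf As b (y k)) ->
    (forall k, (1 <= k)%N -> x k = As^t* *m y k) ->
    (forall k, (1 <= k)%N -> is_phase_argmin (x k) x0 (alpha k)) ->
    norm2 (x 1%N - x0) < eps ->
    forall k, (1 <= k)%N ->
      norm2 (alpha k *: x k - x0) <= gamma ^+ k.-1 * norm2 (x 1%N - x0)].
Proof.
have Pp := range_projP; have Qp := tangent_projP y0.
have [ga [ga0 ga1 dec Jinv Jle]] := two_projections Pp Qp.
have [K [d [K0 d0 rem]]] := remainder_bound y0.
have y00 : 0 < vnorm y0.
  by rewrite vnorm_rdot sqrtr_gt0; apply: rdot_y0_gt0; exact: y0_neq0.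
(* [ga + 2 * eta = 1]: one [eta] pays for the perturbation of [g], giving [gamma = ga + eta], the
   other for the drift of [f]. *)
pose eta := (1 - ga) / 2; pose gamma := (1 + ga) / 2.
have eta0 : 0 < eta by rewrite /eta; lra.
have den1 : 0 < 21 * K + 1 by lra.
have den2 : 0 < 2 * (1 + 3 * K) by lra.
(* [21 = 7 * 3]: realignment costs [7] and the reflected remainder [3]. The last bound meets the
   smallness condition of realignment; the added [1] keeps the denominator positive when [K = 0]. *)
pose delta := Num.min (Num.min d 1)
  (Num.min (eta / (21 * K + 1)) (vnorm y0 / (2 * (1 + 3 * K)))).
have delta0 : 0 < delta.
  rewrite !lt_min d0 ltr01 /=; apply/andP; split; exact: divr_gt0.
have /andP[/andP[dd d1] /andP[de dy]] : (delta <= d) && (delta <= 1) &&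
    ((delta <= eta / (21 * K + 1)) && (delta <= vnorm y0 / (2 * (1 + 3 * K)))).
  by rewrite -!le_min lexx.
rewrite ler_pdivlMr// in de; rewrite ler_pdivlMr// in dy.
have step (e : C) f g : normc e = 1 -> P f = 0 -> Q f = 0 ->
    (exists h, g = P h - Q h) -> vnorm f + vnorm g <= delta ->
    exists (e' : C) (f' g' : V), [/\ normc e' = 1, P f' = 0 /\ Q f' = 0,
      exists h, g' = P h - Q h, Sf As b (e *: (y0 + f + g)) = e' *: (y0 + f' + g') &
      vnorm f' + vnorm g' <= delta /\ vnorm g' <= gamma * vnorm g].
  move=> e1 Pf Qf [h gE] small.
  have [nz re] := rem f g Qf (le_trans small dd).
  set r := remainder y0 f g in re; pose E := 2 *: P r - r.
  have F0 := vnorm_ge0 f; have G0 := vnorm_ge0 g.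
  have nE : vnorm E <= 3 * K * (vnorm f + vnorm g) * vnorm g.
    have n2 : vnorm (2 *: P r) = 2 * vnorm (P r).
      have -> : 2 *: P r = P r + P r by rewrite scaler_nat mulr2n.
      rewrite !vnorm_rdot rdotDl !rdotDr.
      have -> : rdot (P r) (P r) + rdot (P r) (P r) +
        (rdot (P r) (P r) + rdot (P r) (P r)) = 2 ^+ 2 * rdot (P r) (P r) by ring.
      by rewrite sqrtrM ?sqr_ge0// sqrtr_sqr ger0_norm.
    have := real_projection_le r Pp; have := vnormB (2 *: P r) r.
    rewrite n2 -/E; lra.
  have Jg : vnorm (dr_step P Q g) <= ga * vnorm g by rewrite gE.
  have sG : (vnorm f + vnorm g) * vnorm g <= delta * vnorm g by rewrite ler_wpM2r.
  have KsG : K * ((vnorm f + vnorm g) * vnorm g) <= K * (delta * vnorm g).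
    by rewrite ler_wpM2l.
  have nE' : vnorm E <= 3 * (K * (delta * vnorm g)) by move: nE KsG; lra.
  have eE : 7 * vnorm E <= eta * vnorm g.
    have := ler_wpM2r G0 de.
    have : 0 <= delta * vnorm g by rewrite mulr_ge0// ltW.
    move: nE'; lra.
  have Jg' : vnorm (dr_step P Q g) <= vnorm g.
    have := ler_wpM2r G0 (ltW ga1); rewrite mul1r; exact: le_trans.
  have smallE : vnorm f + vnorm (dr_step P Q g) + vnorm E <= vnorm y0 / 2.
    have : K * (delta * vnorm g) <= K * (delta * 1).
      apply: ler_wpM2l => //; apply: ler_wpM2l; [exact: ltW|lra].
    move: dy nE' Jg' small; lra.
  have [|e2 [f' [g' [e2n [Pf' Qf'] hg' aE [nf' ng']]]]] :=
    realign_perturbation Pp Qp range_proj_scale y0_neq0 range_proj_y0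
      (tangent_proj_iy y0) fixed_intersection dec Pf Qf _ smallE.
    by rewrite gE; exact: Jinv.
  exists (e * e2), f', g'; split => //.
  - by rewrite normcM e1 e2n mulr1.
  - by rewrite Sf_expansion// aE scalerA.
  - by split; move: nf' ng' eE Jg small; rewrite /gamma /eta; lra.
exists (Num.min delta (vnorm y0)), gamma; split.
- by rewrite lt_min delta0.
- by rewrite /gamma; lra.
- by rewrite /gamma; lra.
move=> x y alpha y1 yS xE amin; rewrite -!vnormE lt_min => /andP[sm1 sm2].
have inv k : exists (e : C) (f g : V), [/\ normc e = 1, P f = 0 /\ Q f = 0,
    exists h, g = P h - Q h, y k.+1 = e *: (y0 + f + g) &
    vnorm f + vnorm g <= delta /\ vnorm g <= gamma ^+ k * vnorm (x 1%N - x0)].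
  elim: k => [|k [e [f [g [e1 [Pf Qf] hg yE [small ng]]]]]].
    have n1 : vnorm (y 1%N - y0) = vnorm (x 1%N - x0).
      by rewrite y1 -mulmxBr isometry_norm.
    have Py1 : P (y 1%N) = y 1%N.
      by rewrite y1 /range_proj; congr (_ *m _); rewrite mulmxA iso mul1mx.
    have [|e [g [e1 hg aE ng]]] := align_start Pp Qp range_proj_scale y0_neq0
      range_proj_y0 (tangent_proj_iy y0) fixed_intersection dec Py1.
      by rewrite n1.
    have P0 : P 0 = 0 by rewrite /range_proj !mulmx0.
    have Q0 : Q 0 = 0.
      by apply/colP => i; rewrite /tangent_proj 3!mxE !mul0r.
    have n0 : vnorm (0 : V) = 0 by rewrite vnorm_rdot rdot0l sqrtr0.
    exists e, 0, g; split => //; first by rewrite addr0.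
    rewrite n0 add0r expr0 mul1r -n1; split => //.
    by apply: (le_trans ng); rewrite n1 ltW.
  have [e' [f' [g' [e1' PQf' hg' SE [small' ng']]]]] := step e f g e1 Pf Qf hg small.
  exists e', f', g'; split => //; first by rewrite yS// yE.
  split => //; apply: (le_trans ng'); rewrite exprS -mulrA.
  by rewrite ler_wpM2l// /gamma; lra.
case=> // k _ /=; rewrite -!vnormE.
have [e [f [g [e1 [Pf Qf] hg yE [_ ng]]]]] := inv k.
apply: le_trans ng.
(* Minimality of [alpha] is compared with the phase [conj e]; then [A] kills [f], and [A g] is no
   longer than [g]. *)
have [_ /(_ (Num.conj e))] := amin k.+1 isT.
rewrite normr_normc normc_conj e1 -!vnormE => /(_ erefl) h; apply: (le_trans h).
have Af : As^t* *m f = 0.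
  have : As^t* *m P f = As^t* *m f by rewrite /range_proj mulmxA iso mul1mx.
  by rewrite Pf mulmx0.
have -> : Num.conj e *: x k.+1 - x0 = As^t* *m g.
  rewrite xE// yE -scalemxAr scalerA mulrC normc1_conj// scale1r.
  by rewrite !mulmxDr Af addr0 mulmxA iso mul1mx addrC addKr.
by rewrite -[X in X <= _]isometry_norm; exact: (real_projection_le g Pp).
Qed.

End LocalConvergence.

(** Chance enters only through the genericity of two masks; on that event uniqueness and local
    convergence are deterministic. *)
Theorem corollary5p4 (R : realType) (d : nat) (hd : (2 <= d)%N)
    (M : 'I_d -> nat) (x0 : object R M) (hx0 : rank_ge2 x0)
    (l : nat) (hl : (2 <= l)%N)
    (disp : measure_display) (T : measurableType disp) (P : probability T R)
    (phi : 'I_l -> grid M -> {RV P >-> R})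
    (hphi : exists j0 : 'I_l, independent_continuous_mask phi j0)
    (c : R[i])
    (hc : forall t : T, (Astar c (masks phi t))^t* *m Astar c (masks phi t)
                        = 1%:M) :
  {ae P, forall t : T,
    let As := Astar c (masks phi t) in
    let A := As^t* in
    let b := absv (As *m x0) in
    exists eps gamma : R, [/\ 0 < eps, 0 <= gamma, gamma < 1 &
      forall (x : nat -> object R M)
             (y : nat -> 'cV[R[i]]_(\sum_(j < l) #|freqs M|))
             (alpha : nat -> R[i]),
        y 1%N = As *m x 1%N ->
        (forall k, (1 <= k)%N -> y k.+1 = Sf As b (y k)) ->
        (forall k, (1 <= k)%N -> x k = A *m y k) ->
        (forall k, (1 <= k)%N -> is_phase_argmin (x k) x0 (alpha k)) ->
        norm2 (x 1%N - x0) < eps ->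
        forall k, (1 <= k)%N ->
          norm2 (alpha k *: x k - x0)
          <= gamma ^+ k.-1 * norm2 (x 1%N - x0)]}.
Proof.
have [j0 hj0] := hphi.
have [j1 j10] : exists j1 : 'I_l, j1 != j0.
  have : (1 < #|'I_l|)%N by rewrite card_ord.
  move=> /card_gt1P[a [b [_ _ ab]]].
  by have [ja|] := eqVneq a j0; [exists b; rewrite -ja eq_sym|exists a].
apply: filterS (generic_masks hj0 j10) => t gen.
set As := Astar c (masks phi t).
have iso : As^t* *m As = 1%:M := hc t.
have z0 : grid M by exact: (finfun (fun j => ord0)).
have [p [x0p _ _]] := rank_ge2_third_point hx0 z0 z0.
(* The isometry forces [c] to be nonzero, because the grid has a point. *)
have c0 : c != 0.
  apply/eqP => c0; have := congr1 (fun A : 'M[R[i]]_#|grid M| => A (enum_rank p) (enum_rank p)) iso.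
  rewrite /As c0 /Astar scale0r mulmx0 !mxE eqxx => /esym/eqP.
  by rewrite oner_eq0.
have x0n0 : x0 != 0 by apply: contraNneq x0p => ->; rewrite mxE.
apply: (local_convergence iso x0n0) => x hx.
apply: (mask_uniqueness c0 _ _ hx0 gen hx) => j n; rewrite /masks.
  rewrite -expiN; apply: (mulfI (expi_neq0 (phi j n t))).
  by rewrite expiVE divff// expi_neq0.
exact: expi_neq0.
Qed.
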